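(* (1) For every class $\mathcal{C}\in\{\mathsf{DFA},\mathsf{NFA},\mathsf{DPDA},\mathsf{PDA}\}$, the problems $\mathsf{TED}(\mathcal{C},\mathsf{PDA})$ and $\mathsf{FED}(\mathcal{C},\mathsf{PDA})$ are undecidable. (2) For every class $\mathcal{C}\in\{\mathsf{DPDA},\mathsf{PDA}\}$, the problem $\mathsf{FED}(\mathcal{C},\mathsf{DPDA})$ is undecidable.
   Context: A pushdown automaton (PDA) is a tuple $(\Sigma,\Gamma,Q,S,\delta,F)$ with input alphabet $\Sigma$, finite stack alphabet $\Gamma$, finite state set $Q$, initial states $S\subseteq Q$, a finite transition relation $\delta\subseteq Q\times\Sigma\times(\Gamma\cup\{\bot\})\times Q\times\Gamma^*$ and final states $F\subseteq Q$. A run on $w=w[1]\dots w[k]$ is a sequence $\pi[0],\dots,\pi[k]$ in $Q\times\Gamma^*$ with $\pi[0]\in S\times\{\epsilon\}$ such that for each $i\in\{1,\dots,k\}$ either $\pi[i-1]=(q,\epsilon)$, $\pi[i]=(q',u')$ and $(q,w[i],\bot,q',u')\in\delta$, or $\pi[i-1]=(q,ua)$ with $a\in\Gamma$, $\pi[i]=(q',uu')$ and $(q,w[i],a,q',u')\in\delta$. It is accepting if $\pi[k]\in F\times\{\epsilon\}$. $\mathcal{L}(\mathcal{A})$ is the set of words having an accepting run. A PDA is deterministic (DPDA) if $|S|=1$ and $\delta$ is a (possibly partial) function from $Q\times\Sigma\times(\Gamma\cup\{\bot\})$ to $Q\times\Gamma^*$. An NFA is a PDA with empty stack alphabet (an ordinary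 nondeterministic finite automaton); a DFA is a deterministic NFA. $\mathsf{PDA},\mathsf{DPDA},\mathsf{NFA},\mathsf{DFA}$ denote the classes of these automata. The edit distance $ed(w_1,w_2)$ of two words is the minimal number of single-letter insertions, deletions and substitutions transforming $w_1$ into $w_2$. For languages, $ed(\mathcal{L}_1,\mathcal{L}_2)=\sup_{w_1\in\mathcal{L}_1}\inf_{w_2\in\mathcal{L}_2}ed(w_1,w_2)$. The problem $\mathsf{TED}(\mathcal{C}_1,\mathcal{C}_2)$: given $\mathcal{A}_1\in\mathcal{C}_1$, $\mathcal{A}_2\in\mathcal{C}_2$ and an integer $k\ge 0$, decide whether $ed(\mathcal{L}(\mathcal{A}_1),\mathcal{L}(\mathcal{A}_2))\le k$. The problem $\mathsf{FED}(\mathcal{C}_1,\mathcal{C}_2)$: given $\mathcal{A}_1\in\mathcal{C}_1$, $\mathcal{A}_2\in\mathcal{C}_2$, decide whether $ed(\mathcal{L}(\mathcal{A}_1),\mathcal{L}(\mathcal{A}_2))<\infty$. *)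

(* Defs.v *)
From HB Require Import structures.
From mathcomp Require Import all_boot all_order all_algebra.
From mathcomp Require Import boolp classical_sets constructive_ereal.

Set Implicit Arguments.
Unset Strict Implicit.
Unset Printing Implicit Defensive.

Local Open Scope nat_scope.

(* Letters, stack symbols and states are drawn from [nat], and finite sets of
   them are given by lists in which order and repetitions are irrelevant, so
   that automata are finite objects that can be the input of an algorithm.
   Distinct automata may have distinct input alphabets. *)
Definition letter := nat.
Definition state := nat.
Definition stack_symbol := nat.

(* [(q, a, X, q', u')] with [X = None] for the bottom marker. *)
Definition transition : Type :=
  state * letter * option stack_symbol * state * seq stack_symbol.

Definition wf_transition (Sigma Gamma Q : seq nat) (t : transition) : bool :=
  let: (q, a, X, q', u') := t in
  [&& q \in Q, a \in Sigma, (if X is Some x then x \in Gamma else true),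
      q' \in Q & all (mem Gamma) u'].

Record pda := Pda {
  inputs : seq letter;
  stacks : seq stack_symbol;
  states : seq state;
  init : seq state;
  delta : seq transition;
  final : seq state;
  init_states : {subset init <= states};
  delta_wf : all (wf_transition inputs stacks states) delta;
  final_states : {subset final <= states} }.

(* The top of the stack is the last element of the list. *)
Definition config : Type := state * seq stack_symbol.

Definition step (A : pda) (a : letter) (c c' : config) : Prop :=
  (exists q q' u', [/\ c = (q, [::]), c' = (q', u')
     & (q, a, None, q', u') \in delta A]) \/
  (exists q u x q' u', [/\ x \in stacks A, c = (q, rcons u x), c' = (q', u ++ u')
     & (q, a, Some x, q', u') \in delta A]).

(* The defaults of [nth] are never used: indices stay within bounds. *)
Definition run (A : pda) (w : seq letter) (pi : seq config) : Prop :=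
  [/\ size pi = (size w).+1,
      exists2 q, q \in init A & nth (0, [::]) pi 0 = (q, [::])
    & forall i, i < size w ->
        step A (nth 0 w i) (nth (0, [::]) pi i) (nth (0, [::]) pi i.+1)].

Definition accepting (A : pda) (w : seq letter) (pi : seq config) : Prop :=
  exists2 q, q \in final A & nth (0, [::]) pi (size w) = (q, [::]).

Definition language (A : pda) : set (seq letter) :=
  [set w | exists2 pi, run A w pi & accepting A w pi]%classic.

Definition deterministic (A : pda) : Prop :=
  (exists q, init A =i [:: q]) /\
  (forall q a X q1 u1 q2 u2, (q, a, X, q1, u1) \in delta A ->
     (q, a, X, q2, u2) \in delta A -> (q1, u1) = (q2, u2)).

Definition is_nfa (A : pda) : Prop := stacks A = [::].

Inductive pda_class := DFA | NFA | DPDA | PDA.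

Definition in_class (C : pda_class) (A : pda) : Prop :=
  match C with
  | DFA => is_nfa A /\ deterministic A
  | NFA => is_nfa A
  | DPDA => deterministic A
  | PDA => True
  end.

Inductive edit_step : seq letter -> seq letter -> Prop :=
| edit_insert u a v : edit_step (u ++ v) (u ++ a :: v)
| edit_delete u a v : edit_step (u ++ a :: v) (u ++ v)
| edit_subst u a b v : edit_step (u ++ a :: v) (u ++ b :: v).

Inductive edits : nat -> seq letter -> seq letter -> Prop :=
| edits0 w : edits 0 w w
| editsS n w1 w2 w3 : edit_step w1 w2 -> edits n w2 w3 -> edits n.+1 w1 w3.

Lemma edits_ex (w1 w2 : seq letter) : exists n, `[< edits n w1 w2 >].
Proof.
suff [n wn] : exists n, edits n w1 w2 by exists n; apply/asboolP.
elim: w1 => [|a w1 [n IHn]].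
  elim: w2 => [|b w2 [n IHn]]; first by exists 0; constructor.
  have aux m x y : edits m x y -> edits m.+1 x (b :: y).
    elim=> [w|k u v z uv _ IH]; last exact: editsS uv IH.
    exact: editsS (edit_insert [::] b w) (edits0 _).
  by exists n.+1; apply: aux.
by exists n.+1; apply: editsS IHn; apply: (edit_delete [::]).
Qed.

Definition ed (w1 w2 : seq letter) : nat := ex_minn (edits_ex w1 w2).

(* Distances between languages take values in the nonnegative part of
   [\bar int], where the empty infimum is [+oo] and the empty supremum is [0];
   all other suprema and infima of such values exist in [\bar int]. *)
Definition lang_ed (L1 L2 : set (seq letter)) : \bar int :=
  supremum (0%:Z%:E)%E
    [set infimum +oo%E [set ((ed w1 w2)%:Z%:E)%E | w2 in L2] | w1 in L1]%classic.

(* Kleene's partial recursive functions, on lists of arguments; projections of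
   missing arguments are [0]. *)
Inductive recfun :=
| Zero
| Succ
| Proj of nat
| Comp of recfun & seq recfun
| Prec of recfun & recfun
| Mu of recfun.

Inductive eval : recfun -> seq nat -> nat -> Prop :=
| eval_zero xs : eval Zero xs 0
| eval_succ xs : eval Succ xs (nth 0 xs 0).+1
| eval_proj i xs : eval (Proj i) xs (nth 0 xs i)
| eval_comp f gs xs ys y :
    size ys = size gs ->
    (forall i, i < size gs -> eval (nth Zero gs i) xs (nth 0 ys i)) ->
    eval f ys y -> eval (Comp f gs) xs y
| eval_prec0 f g xs y : eval f xs y -> eval (Prec f g) (0 :: xs) y
| eval_precS f g n xs r y :
    eval (Prec f g) (n :: xs) r -> eval g (n :: r :: xs) y ->
    eval (Prec f g) (n.+1 :: xs) y
| eval_mu f xs n (r : nat -> nat) :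
    eval f (n :: xs) 0 ->
    (forall m, m < n -> eval f (m :: xs) (r m).+1) ->
    eval (Mu f) xs n.

(* [legal] singles out the instances of the problem within the type; nothing is
   asked of an algorithm on inputs that do not encode a legal instance. *)
Record problem := Problem {
  instance : Type;
  encode : instance -> nat;
  legal : instance -> Prop;
  answer : instance -> Prop }.

Definition rec_decidable (P : problem) : Prop :=
  exists f : recfun, forall x : instance P, legal x ->
    (answer x -> eval f [:: encode x] 1) /\
    (~ answer x -> eval f [:: encode x] 0).

Definition undecidable (P : problem) : Prop := ~ rec_decidable P.

(* [CodeSeq.code] is an explicit computable bijection [seq nat -> nat]. *)
Definition code_bot (X : option stack_symbol) : nat :=
  if X is Some x then x.+1 else 0.

Definition code_transition (t : transition) : nat :=
  let: (q, a, X, q', u') := t in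
  CodeSeq.code [:: q; a; code_bot X; q'; CodeSeq.code u'].

Definition code_pda (A : pda) : nat :=
  CodeSeq.code [:: CodeSeq.code (inputs A); CodeSeq.code (stacks A);
    CodeSeq.code (states A); CodeSeq.code (init A);
    CodeSeq.code (map code_transition (delta A)); CodeSeq.code (final A)].

Definition TED (C1 C2 : pda_class) : problem := {|
  instance := pda * pda * nat;
  encode := fun x => let: (A1, A2, k) := x in
    CodeSeq.code [:: code_pda A1; code_pda A2; k];
  legal := fun x => let: (A1, A2, k) := x in in_class C1 A1 /\ in_class C2 A2;
  answer := fun x => let: (A1, A2, k) := x in
    (lang_ed (language A1) (language A2) <= k%:Z%:E)%E |}.

Definition FED (C1 C2 : pda_class) : problem := {|
  instance := pda * pda;
  encode := fun x => let: (A1, A2) := x in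
    CodeSeq.code [:: code_pda A1; code_pda A2];
  legal := fun x => let: (A1, A2) := x in in_class C1 A1 /\ in_class C2 A2;
  answer := fun x => let: (A1, A2) := x in
    (lang_ed (language A1) (language A2) < +oo)%E |}.

(* Main.v *)
(* All problems are reduced from the halting problem, encoded by pairs of stacks.

   A run of a counter machine is recorded as a word x over a fixed alphabet whose
   letters push or pop symbols on two stacks; together these hold, to the left and
   to the right of a head, a tape in which each register is the number of marks in
   some section. The length of the tape is guessed, so every letter changes both
   heights by one. Thus the machine halts iff some x respects a regular control and
   is a valid history of both stacks.

   Let L1 consist of the words 0 x1 1 0 x2 1 ... in which each block xi obeys the
   control, and let L2 consist of those in which each xi is invalid for some stack.
   If the machine does not halt then L1 is included in L2; otherwise, for a halting
   history x, the word (0 x 1)^n of L1 is at distance at least n from L2, because an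
   edit destroys at most one of its blocks. L1 is regular and L2 is accepted by a
   fixed PDA that guesses an error. For deterministic L2, let L1 also check the left
   stack, so that L2 only has to find an error on the right one. A deterministic
   automaton that has found an error must still empty its stack; it can do so
   because the history of the left stack determines all changes of the height of
   the right one, and makes this height return to 0.

   For the diagonal argument, the machine that runs a presumed decision procedure
   is given as input the code e of the e-independent part of the control automaton.
   The code of the whole instance is then a recursive function of e alone, and
   contradicts the answer of the procedure. *)

Require Import Defs.
From mathcomp Require Import all_boot all_order all_algebra.
From HB Require Import structures.
From mathcomp Require Import boolp classical_sets constructive_ereal zify.

Set Implicit Arguments.
Unset Strict Implicit.
Unset Printing Implicit Defensive.

Local Open Scope nat_scope.

(** * Runs and block languages *)

(* Here stacks are lists whose head is the top; those of [step] are their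
   reversals. *)
Definition hstep (A : pda) (a : letter) (c c' : config) : Prop :=
  exists2 u, (c.1, a, ohead c.2, c'.1, u) \in delta A &
    c'.2 = rev u ++ behead c.2.

Definition rev_config (c : config) : config := (c.1, rev c.2).

Lemma rev_configK : involutive rev_config.
Proof. by case=> q s; rewrite /rev_config /= revK. Qed.

Lemma delta_stack (A : pda) q a x q' u :
  (q, a, Some x, q', u) \in delta A -> x \in stacks A.
Proof. by move=> /(allP (delta_wf A)) /= /and5P[]. Qed.

Lemma hstepP A a c c' : step A a (rev_config c) (rev_config c') <-> hstep A a c c'.
Proof.
case: c c' => [q s] [q' s']; split; rewrite /rev_config /hstep /=.
  case=> [[p [p' [u [[-> es] [-> es'] dl]]]]|[p [v [x [p' [u [xA [-> es] [-> es'] dl]]]]]]].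
    by exists u; rewrite -[s]revK es //= cats0 -es' revK.
  by exists u; rewrite -[s]revK es rev_rcons //= -rev_cat -es' revK.
case: s => [|x s] /= [u dl ->].
  by left; exists q, q', u; rewrite cats0 revK.
right; exists q, (rev s), x, q', u; rewrite rev_cons rev_cat revK.
by split=> //; apply: delta_stack dl.
Qed.

Fixpoint reach (A : pda) (w : seq letter) (c c' : config) : Prop :=
  if w is a :: w' then exists2 c1, hstep A a c c1 & reach A w' c1 c' else c = c'.

Lemma reach_cat A u v c c' :
  reach A (u ++ v) c c' <-> exists2 c1, reach A u c c1 & reach A v c1 c'.
Proof.
elim: u c => [|a u IH] c /=; first by split=> [|[c1 ->]//]; exists c.
split=> [[c1 s1 /IH[c2 r1 r2]]|[c2 [c1 s1 r1] r2]].
  by exists c2 => //; exists c1.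
by exists c1 => //; apply/IH; exists c2.
Qed.

Lemma languageP A w : language A w <->
  exists q q', [/\ q \in init A, q' \in final A & reach A w (q, [::]) (q', [::])].
Proof.
have nthc (c : config) pi i : nth (0, [::]) (map rev_config pi) i =
    rev_config (nth (0, [::]) pi i).
  have [lt|ge] := ltnP i (size pi); first exact: nth_map.
  by rewrite !nth_default ?size_map.
suff aux c c' : reach A w c c' <-> exists pi : seq config,
    [/\ size pi = (size w).+1, nth (0, [::]) pi 0 = c,
        nth (0, [::]) pi (size w) = c' & forall i, i < size w ->
        hstep A (nth 0 w i) (nth (0, [::]) pi i) (nth (0, [::]) pi i.+1)].
  split=> [[pi [sz [q qi e0] st] [q' qf e1]]|[q [q' [qi qf /aux[pi [sz e0 e1 st]]]]]].
    exists q, q'; split=> //; apply/aux; exists (map rev_config pi).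
    rewrite size_map !nthc ?e0 ?e1 //; split=> // i lti.
    by rewrite !nthc //; apply/hstepP; rewrite !rev_configK; apply: st.
  exists (map rev_config pi); last by exists q' => //; rewrite nthc ?e1.
  split; rewrite ?size_map ?nthc ?e0 ?e1 //; first by exists q.
  by move=> i lti; rewrite !nthc //; apply/hstepP; apply: st.
elim: w c => [|a w IH] c /=; split.
- by move=> ->; exists [:: c'].
- by case=> pi [_ -> ->].
- case=> c1 s1 /IH[pi [sz e0 e1 st]]; exists (c :: pi); split=> //=; first by rewrite sz.
  by case=> [_|i lti] /=; [rewrite e0 | apply: st].
case=> -[|c0 pi]; first by case.
case=> /= [[sz]] -> e1 st; exists (nth (0, [::]) pi 0); first exact: (st 0).
by apply/IH; exists pi; split=> // i lti; apply: (st i.+1).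
Qed.

Definition block (x : seq letter) : seq letter := 0 :: rcons x 1.

Definition blocks (X : seq letter -> Prop) (w : seq letter) : Prop :=
  exists2 xs, (forall x, x \in xs -> X x) & w = flatten (map block xs).

(* Transitions of an automaton that reads [0 x 1 0 y 1 ...]: state 0 is only
   visited between two blocks. *)
Definition block_transition (t : transition) : bool :=
  let: (q, a, X, q', u) := t in
  if q == 0 then [&& a == 0, X == None & q' != 0]
  else if a == 1 then q' == 0 else (1 < a) && (q' != 0).

Definition block_lang (A : pda) (x : seq letter) : Prop :=
  all (leq 2) x /\ reach A (block x) (0, [::]) (0, [::]).

(** An accepting run splits at its visits to state 0. The stack is empty at each of them: either the
    run ends there, or the transition that reads the next 0 requires the bottom marker. *)
Lemma block_language A w :
  init A =i [:: 0] -> final A =i [:: 0] -> all block_transition (delta A) ->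
  language A w <-> blocks (block_lang A) w.
Proof.
move=> iA fA bA; have btr t : t \in delta A -> block_transition t by move/(allP bA).
transitivity (reach A w (0, [::]) (0, [::])).
  rewrite languageP; split=> [[q [q' []]]|rw]; last by exists 0, 0; rewrite iA fA inE.
  by rewrite iA fA !inE => /eqP-> /eqP->.
split=> [|[xs Xxs ->]]; last first.
  elim: xs Xxs => [//|x xs IH] Xxs.
  rewrite map_cons -[flatten _]/(block x ++ flatten (map block xs)).
  apply/reach_cat; exists (0, [::]).
    by case: (Xxs x) => //; rewrite inE eqxx.
  by apply: IH => y yxs; apply: Xxs; rewrite inE yxs orbT.
have inside v (q : state) s : reach A v (q, s) (0, [::]) -> q != 0 ->
    exists x v' s', [/\ v = rcons x 1 ++ v', all (leq 2) x,
       reach A (rcons x 1) (q, s) (0, s') & reach A v' (0, s') (0, [::])].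
  elim: v q s => [|a v IH] q s /=; first by case=> ->.
  case=> -[q1 s1] hs rv q0; have [u dl _] := hs.
  move/btr: dl; rewrite /= (negPf q0).
  have [a1 /eqP q1E|a1 /andP[a2 q10]] := eqVneq a 1.
    by subst a q1; exists [::], v, s1; split=> //=; exists (0, s1).
  have [x [v' [s' [-> al r1 r2]]]] := IH _ _ rv q10.
  by exists (a :: x), v', s'; split=> //=; [rewrite a2 | exists (q1, s1)].
have [n] := ubnP (size w); elim: n w => // n IHn [|a w] szw; first by exists [::].
case=> -[q1 s1] hs rw; have [u dl _] := hs.
move/btr: dl => /= /andP[/eqP a0 q10]; subst a.
have [x [w' [s' [ew al r1 r2]]]] := inside _ _ _ rw q10.
have s'0 : s' = [::].
  case: w' r2 {ew} => [[]//|b w'] /= [c [v dl _ _]].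
  by move/btr: dl => /= /and3P[_]; case: s' {r1}.
subst s'; have [|xs Xxs ew'] := IHn w' _ r2.
  by move: szw; rewrite /= ew size_cat; lia.
exists (x :: xs).
  move=> y; rewrite inE => /orP[/eqP->|/Xxs//].
  by split=> //=; exists (q1, s1).
by rewrite ew ew'.
Qed.

(** * Edit distance of block languages *)

Lemma ed_edits w1 w2 : edits (ed w1 w2) w1 w2.
Proof. by rewrite /ed; case: ex_minnP => n /asboolP. Qed.

Lemma ed_refl w : ed w w = 0.
Proof.
rewrite /ed; case: ex_minnP => n _ /(_ 0) le; apply/eqP; rewrite -leqn0.
by apply/le/asboolP; constructor.
Qed.

Lemma cat_split (T : Type) (x y u v : seq T) : x ++ y = u ++ v ->
  (exists t, u = x ++ t /\ y = t ++ v) \/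
  (exists a t, x = u ++ a :: t /\ v = a :: t ++ y).
Proof.
elim: x u => [|b x IH] [|c u] /=.
- by move=> ->; left; exists [::].
- by move=> ->; left; exists (c :: u).
- by move=> <-; right; exists b, x.
case=> <- /IH[[t [-> ->]]|[a [t [-> ->]]]]; first by left; exists t.
by right; exists a, t.
Qed.

(** An edit is local to one factor; an insertion at the border is attributed to the right one. *)
Lemma edit_step_cat x y z : edit_step (x ++ y) z ->
  (exists2 x', edit_step x x' & z = x' ++ y) \/
  (exists2 y', edit_step y y' & z = x ++ y').
Proof.
move: {1 3}(x ++ y) (erefl (x ++ y)) => w ew st.
case: st ew => [u a v|u a v|u a b v] /esym/cat_split.
- case=> [[t [-> ->]]|[b [t [-> ->]]]].
    right; exists (t ++ a :: v); first exact: edit_insert.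
    by rewrite -catA.
  left; exists (u ++ a :: b :: t); first exact: edit_insert.
  by rewrite -catA.
- case=> [[t [-> ->]]|[b [t [-> [_ ->]]]]].
    right; exists (t ++ v); first exact: edit_delete.
    by rewrite -catA.
  left; exists (u ++ t); first exact: edit_delete.
  by rewrite -catA.
case=> [[t [-> ->]]|[c [t [-> [_ ->]]]]].
  right; exists (t ++ b :: v); first exact: edit_subst.
  by rewrite -catA.
left; exists (u ++ b :: t); first exact: edit_subst.
by rewrite -catA.
Qed.

Fixpoint disjoint_factors (b : seq letter) (m : nat) (w : seq letter) : Prop :=
  if m is m'.+1 then exists p s, w = p ++ b ++ s /\ disjoint_factors b m' s
  else True.

Lemma disjoint_factors_cat b m p w :
  disjoint_factors b m w -> disjoint_factors b m (p ++ w).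
Proof.
by case: m => //= m [q [s [-> dm]]]; exists (p ++ q), s; rewrite -catA.
Qed.

Lemma disjoint_factors_pred b m w :
  disjoint_factors b m.+1 w -> disjoint_factors b m w.
Proof. by case=> p [s [-> dm]]; do 2!apply: disjoint_factors_cat. Qed.

(** One edit spoils at most one of the occurrences, the one it falls into. *)
Lemma edit_step_factors b m w w' : edit_step w w' ->
  disjoint_factors b m.+1 w -> disjoint_factors b m w'.
Proof.
elim: m w w' => // m IH w w' st [p [s [ew ds]]]; subst w.
case: (edit_step_cat st) => [[p' _ ->]|[y st' ->]].
  by apply: disjoint_factors_pred; exists p', s.
apply: disjoint_factors_cat.
case: (edit_step_cat st') => [[b' _ ->]|[s' st'' ->]].
  exact: disjoint_factors_cat.
by exists [::], s'; split=> //; apply: IH st'' ds.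
Qed.

Lemma edits_factors b m n w w' : edits n w w' ->
  disjoint_factors b (n + m) w -> disjoint_factors b m w'.
Proof.
by elim=> // k w1 w2 w3 st _ IH; rewrite addSn => /(edit_step_factors st)/IH.
Qed.

Lemma lang_ed_sub (L1 L2 : set (seq letter)) :
  (L1 `<=` L2)%classic -> (lang_ed L1 L2 <= 0%:Z%:E)%E.
Proof.
move=> sub; rewrite /lang_ed.
set S := [set infimum _ _ | _ in _]%classic.
have S0 z : S z -> z = 0%:Z%:E%E.
  case=> w Lw <-; rewrite /infimum ifF; last first.
    by apply/negbTE/set0P; exists (ed w w)%:Z%:E%E; exists w => //; apply: sub.
  (* [infimum] chooses an element of the set of infima; this set has at most one element, so it
     suffices that 0 belongs to it. *)
  apply: xget_subset1; last exact: is_subset1_infimums.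
  split=> [_ [v _ <-]|y]; first by rewrite lee_fin.
  by apply; exists w; [apply: sub | rewrite ed_refl].
(* If [L1] is empty, so is [S], and the supremum takes its default value 0. *)
have [->|/set0P[z Sz]] := eqVneq S set0%classic; first by rewrite supremum0.
suff -> : S = [set 0%:Z%:E%E]%classic by rewrite supremum1.
by apply/seteqP; split=> [y /S0->|y ->] //; rewrite -(S0 _ Sz).
Qed.

Lemma lang_ed_far (L1 L2 : set (seq letter)) :
  (forall k, exists2 w1, L1 w1 & forall w2, L2 w2 -> k < ed w1 w2) ->
  lang_ed L1 L2 = +oo%E.
Proof.
move=> far; rewrite /lang_ed.
set I := fun w1 => _; set S := [set I w1 | w1 in L1]%classic.
(* The infimum of a nonempty set of natural numbers is attained, and that of the empty set is [+oo];
   so the strict bound survives. *)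
have Ige k w1 : (forall w2, L2 w2 -> k < ed w1 w2) -> (k%:Z%:E < I w1)%E.
  move=> lt; rewrite /I /infimum; case: eqP => [_|/eqP/set0P[_ [w0 Lw0 _]]].
    by rewrite ltry.
  have exw : exists n, `[< exists2 w2, L2 w2 & ed w1 w2 = n >].
    by exists (ed w1 w0); apply/asboolP; exists w0.
  case: (ex_minnP exw) => n /asboolP[w2 Lw2 en] min.
  rewrite (@xget_subset1 _ _ _ n%:Z%:E%E); first by rewrite lte_fin -en; apply: lt.
    split=> [_ [w Lw <-]|y]; last by apply; exists w2; rewrite ?en.
    by rewrite lee_fin; apply/min/asboolP; exists w.
  exact: is_subset1_infimums.
rewrite /supremum ifF; last first.
  by apply/negbTE/set0P; have [w Lw _] := far 0; exists (I w); exists w.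
apply: xget_subset1; last exact: is_subset1_supremums.
split=> [y _|y uby]; first exact: leey.
(* An upper bound exceeds every natural number, so it can only be [+oo]. *)
have ub k : (k%:Z%:E < y)%E.
  by have [w Lw /Ige lt] := far k; apply: Order.POrderTheory.lt_le_trans lt _; apply: uby; exists w.
case: y {uby} ub => [z|//|] ub; last by have := ub 0.
by have := ub `|z|%N; rewrite lte_fin; lia.
Qed.

(** Data letters are at least 2, so the first 1 ends the first block. *)
Lemma block_inj x y u v : all (leq 2) x -> all (leq 2) y ->
  block x ++ u = block y ++ v -> x = y /\ u = v.
Proof.
rewrite /block !cat_cons !cat_rcons => + + [].
elim: x y => [|a x IH] [|b y] //=; first by move=> _ _ [].
- by move=> _ /andP[b2 _] [eb]; rewrite -eb in b2.
- by move=> /andP[a2 _] _ [ea]; rewrite ea in a2.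
by move=> /andP[_ ax] /andP[_ ay] [-> /IH[]// -> ->].
Qed.

(** The letter 0 occurs only at the beginning of blocks, so the factor [block x] must be one of
    them. *)
Lemma blocks_factor (V : seq letter -> Prop) x p s :
  all (leq 2) x -> blocks (fun y => all (leq 2) y /\ ~ V y) (p ++ block x ++ s) -> ~ V x.
Proof.
move=> ax [ys Vys]; elim: ys p Vys => [|y ys IH] p Vys; first by case: p.
have [ay Vy] := Vys y (mem_head _ _).
have Vys' z : z \in ys -> all (leq 2) z /\ ~ V z.
  by move=> zys; apply: Vys; rewrite inE zys orbT.
rewrite map_cons -[flatten _]/(block y ++ flatten (map block ys)).
case: p => [|c p]; first by case/(block_inj ax ay) => ->.
have -> : block y ++ flatten (map block ys) = 0 :: y ++ 1 :: flatten (map block ys).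
  by rewrite /block cat_cons cat_rcons.
case=> _ /esym/cat_split.
case=> [[[|b t] [ep]]|[a [t [ey]]]]; first by [].
  by case=> _ /esym; apply: IH => z /Vys'.
by case=> ea; move: ay; rewrite ey -ea all_cat andbC.
Qed.

(** [L2] is squeezed between two block languages, as the observers do not check the control: they
    must accept invalid blocks that obey [X], and may accept other invalid ones. *)
Lemma lang_ed_blocks (X V : seq letter -> Prop) (L1 L2 : set (seq letter)) :
    (forall w, L1 w <-> blocks X w) ->
    (forall x, X x -> all (leq 2) x) ->
    (forall w, blocks (fun x => X x /\ ~ V x) w -> L2 w) ->
    (forall w, L2 w -> blocks (fun x => all (leq 2) x /\ ~ V x) w) ->
  ((exists2 x, X x & V x) -> lang_ed L1 L2 = +oo%E) /\
  (~ (exists2 x, X x & V x) -> (lang_ed L1 L2 <= 0%:Z%:E)%E).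
Proof.
move=> L1P Xdata subL2 L2sub; split=> [[x Xx Vx]|nXV]; last first.
  apply: lang_ed_sub => w /L1P[xs Xxs ->]; apply: subL2; exists xs => // x xxs.
  by split; [apply: Xxs | move=> Vx; apply: nXV; exists x => //; apply: Xxs].
(* Of [k.+1] copies of a valid block, at most [k] edits leave at least one intact, while no word of
   [L2] contains [block x]. *)
apply: lang_ed_far => k; exists (flatten (map block (nseq k.+1 x))).
  by apply/L1P; exists (nseq k.+1 x) => // y /nseqP[->].
move=> w Lw; rewrite ltnNge; apply/negP => le.
have dk m : disjoint_factors (block x) m (flatten (map block (nseq m x))).
  by elim: m => //= m IH; exists [::], (flatten (map block (nseq m x))).
have := dk k.+1; rewrite -[in disjoint_factors _ _](subnKC le) -addnS.
move/(edits_factors (ed_edits (flatten (map block (nseq k.+1 x))) w)).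
case=> p [s [ew _]]; subst w.
exact: (blocks_factor (Xdata x Xx) (L2sub _ Lw)).
Qed.

(** * Stack letters and the deterministic observer *)

(* Two stacks hold the tape to the left and to the right of a head. Letter
   [a.+2] pushes ([true]) or pops ([false]) one symbol on each of them, as given
   by entry [a] of [ops]. Tape symbols: 0 blank, 1 mark, 2 separator; 3 is a
   counter symbol at the bottom of the left stack. In this order the letters
   are: append [x] to the tape; remove [x] from the tape; move right over [x];
   move right turning 0 into 1; move right turning 1 into 0; move left over
   [x]. *)
Definition ops : seq ((bool * nat) * (bool * nat)) :=
  [:: ((true, 3), (true, 0)); ((true, 3), (true, 1)); ((true, 3), (true, 2));
      ((false, 3), (false, 0)); ((false, 3), (false, 1)); ((false, 3), (false, 2));
      ((true, 0), (false, 0)); ((true, 1), (false, 1)); ((true, 2), (false, 2));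
      ((true, 1), (false, 0)); ((true, 0), (false, 1));
      ((false, 0), (true, 0)); ((false, 1), (true, 1)); ((false, 2), (true, 2))].

Definition alphabet : seq letter := iota 0 16.
Definition symbols : seq stack_symbol := iota 0 5.

Definition data (x : seq letter) : bool := all (fun a => 1 < a < 16) x.

(* [false] is the left stack, [true] the right one. *)
Definition op (s : bool) (a : letter) : bool * nat :=
  let o := nth ((true, 0), (true, 0)) ops (a - 2) in if s then o.2 else o.1.

Arguments op : simpl never.

Definition act (o : bool * nat) (st : seq nat) : option (seq nat) :=
  if o.1 then Some (o.2 :: st)
  else if st is y :: st' then if y == o.2 then Some st' else None else None.

Fixpoint run_stack (s : bool) (x : seq letter) (st : seq nat) : option (seq nat) :=
  if x is a :: x' then obind (run_stack s x') (act (op s a) st) else Some st.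

Definition valid (s : bool) (x : seq letter) : Prop := run_stack s x [::] = Some [::].

Lemma run_stack_cat s x y st :
  run_stack s (x ++ y) st = obind (run_stack s y) (run_stack s x st).
Proof. by elim: x st => //= a x IH st; case: act. Qed.

Lemma run_stack_frame s x st st' t :
  run_stack s x st = Some st' -> run_stack s x (st ++ t) = Some (st' ++ t).
Proof.
elim: x st => [|a x IH] st /=; first by case=> ->.
rewrite /act; case: (op s a) => [[] y] /=; first by move=> /IH.
by case: st => [|z st] //=; case: eqP => //= _ /IH.
Qed.

Lemma op_symbol s a : (op s a).2 < 4.
Proof.
by rewrite /op; move: (a - 2) => b; case: s; do 14?[case: b => [|b] //]; case: b.
Qed.

(** A transition always consumes the top symbol, so a push has to write it back first. *)
Definition keep (X : option stack_symbol) : seq stack_symbol :=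
  if X is Some x then [:: x] else [::].

Lemma push_keep y st : rev (rcons (keep (ohead st)) y) ++ behead st = y :: st.
Proof. by rewrite rev_rcons; case: st. Qed.

Definition tops : seq (option stack_symbol) := None :: map some symbols.

Definition table (n : nat)
    (f : state -> letter -> option stack_symbol -> seq (state * seq stack_symbol)) :
    seq transition :=
  flatten [seq flatten [seq flatten [seq [seq (q, a, X, p.1, p.2) | p <- f q a X]
    | X <- tops] | a <- alphabet] | q <- iota 0 n].

Lemma mem_table n f q a X q' u :
  ((q, a, X, q', u) \in table n f) =
  [&& q < n, a \in alphabet, X \in tops & (q', u) \in f q a X].
Proof.
apply/idP/and4P.
  case/flatten_mapP=> q0 q0n /flatten_mapP[a0 a0L] /flatten_mapP[X0 X0L].
  case/mapP=> -[q1 u1] pf [-> -> -> -> ->].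
  by move: q0n; rewrite mem_iota.
case=> qn aL XL pf; apply/flatten_mapP; exists q; first by rewrite mem_iota.
apply/flatten_mapP; exists a => //; apply/flatten_mapP; exists X => //.
by apply/mapP; exists (q', u).
Qed.

Lemma data_alphabet a : 1 < a < 16 -> a \in alphabet.
Proof. by rewrite mem_iota; lia. Qed.

Lemma top_in_tops (st : seq nat) : all (gtn 5) st -> ohead st \in tops.
Proof.
case: st => [|x st] // /andP[x5 _]; rewrite /tops in_cons; apply/orP; right.
by rewrite -[ohead _]/(some x); apply: map_f; rewrite mem_iota.
Qed.

(* Simulates the right stack: in state 1 exactly, in state 2 (after a mismatch)
   only its height, in state 3 (after an underflow) not at all. A word is
   accepted if an error occurs and the height is 0 at the end. *)
Definition watch_table (q : state) (a : letter) (X : option stack_symbol) :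
    seq (state * seq stack_symbol) :=
  let: (push, y) := op true a in
  match q with
  | 0 => if (a == 0) && (X == None) then [:: (1, [::])] else [::]
  | 1 => if a <= 1 then [::] else
         if push then [:: (1, rcons (keep X) y)]
         else if X is Some x then [:: (if x == y then 1 else 2, [::])]
         else [:: (3, [::])]
  | 2 => if a == 0 then [::] else
         if a == 1 then if X == None then [:: (0, [::])] else [::]
         else if push then [:: (2, rcons (keep X) y)]
         else [:: (if X is Some _ then 2 else 3, [::])]
  | 3 => if (a == 0) || (X != None) then [::] else
         if a == 1 then [:: (0, [::])] else [:: (3, [::])]
  | _ => [::]
  end.

Definition watch : pda.
Proof.
refine (@Pda alphabet symbols (iota 0 4) [:: 0] (table 4 watch_table) [:: 0] _ _ _).
- abstract by move=> q; rewrite !inE => ->.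
- abstract by vm_compute.
- abstract by move=> q; rewrite !inE => ->.
Defined.

Lemma watch_deterministic : deterministic watch.
Proof.
split; first by exists 0.
move=> q a X q1 u1 q2 u2; rewrite !mem_table => /and4P[q4 _ _ +] /and4P[_ _ _].
suff : size (watch_table q a X) <= 1.
  by case: (watch_table q a X) => [|p [|]] //= _; rewrite !inE => /eqP-> /eqP.
rewrite /watch_table; case: (op true a) => push y.
by case: q q4 => [|[|[|[|q]]]] //= _; do ?[case: ifP => //= _]; case: X.
Qed.

Lemma watch_step q a st q' u : all (gtn 5) st -> 1 < a < 16 ->
  (q < 4) && ((q', u) \in watch_table q a (ohead st)) ->
  hstep watch a (q, st) (q', rev u ++ behead st).
Proof.
move=> st5 a2 /andP[q4 wt]; exists u => //=.
by rewrite mem_table q4 data_alphabet // top_in_tops.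
Qed.

Lemma watch_end q : q \in [:: 2; 3] -> hstep watch 1 (q, [::]) (0, [::]).
Proof. by rewrite !inE => /orP[] /eqP->; exists [::]; rewrite ?mem_table. Qed.

Lemma watch_underflow x : data x -> reach watch (rcons x 1) (3, [::]) (0, [::]).
Proof.
elim: x => [_|a x IH /= /andP[a2 dx]] /=.
  by exists (0, [::]) => //; apply: watch_end.
exists (3, [::]); last exact: IH.
apply: (@watch_step 3 a [::] 3 [::]) => //=; rewrite /watch_table.
by case: op => ? ?; do 2?[case: a a2 => [|a] a2 //]; rewrite inE.
Qed.

(* [count (pred1 3)] minus the number of other symbols on the left stack
   changes exactly as the height of the right stack. *)
Definition balanced (l r : seq nat) : bool :=
  size r + count (predC (pred1 3)) l == count (pred1 3) l.

(** Checked letter by letter: a push on the right comes with a push of 3 or a pop of another symbol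
    on the left. The symbol [y] is arbitrary because only heights count. *)
Lemma balanced_push a l l' r : 1 < a < 16 -> act (op false a) l = Some l' ->
  balanced l r -> (op true a).1 -> forall y, balanced l' (y :: r).
Proof.
rewrite /balanced => a2 al bl pa y; move: al pa bl.
do 16?[case: a a2 => [|a] a2 //]; rewrite /act /op /=;
  try (by case=> <- _ /=; lia);
  case: l => [|z l] //=; case: eqP => //= ez [->]; rewrite ?ez /=; lia.
Qed.

Lemma balanced_pop a l l' y r : 1 < a < 16 -> act (op false a) l = Some l' ->
  balanced l (y :: r) -> ~~ (op true a).1 -> balanced l' r.
Proof.
rewrite /balanced => a2 al bl pa; move: al pa bl.
do 16?[case: a a2 => [|a] a2 //]; rewrite /act /op /=;
  try (by case=> <- _ /=; lia);
  case: l => [|z l] //=; case: eqP => //= ez [->]; rewrite ?ez /=; lia.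
Qed.

(** In state 2 the height still follows the left history. This one ends with an empty stack, so by
    [balanced] the height is then 0, unless an underflow has led to state 3 before. *)
Lemma watch_mismatch x l st : data x -> all (gtn 5) st -> balanced l st ->
  run_stack false x l = Some [::] -> reach watch (rcons x 1) (2, st) (0, [::]).
Proof.
elim: x l st => [|a x IH] l st /=.
  move=> _ _ bl [el]; move: bl; rewrite el; case: st => //= _.
  by exists (0, [::]) => //; apply: watch_end.
case/andP=> a2 dx st5 bl; case al: act => [l'|] //= rx.
have := op_symbol true a; case ea: (op true a) => [[] y] /= y4.
  exists (2, y :: st); last first.
    apply: (IH l') => //=; first by rewrite st5; lia.
    by apply: (balanced_push a2 al bl); rewrite ea.
  have := @watch_step 2 a st 2 (rcons (keep (ohead st)) y) st5 a2.
  rewrite push_keep; apply.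
  by rewrite /watch_table ea !ifF ?mem_head //; lia.
case: st st5 bl => [|z st] /= st5 bl.
  exists (3, [::]); last exact: watch_underflow.
  apply: (@watch_step 2 a [::] 3 [::]) => //=.
  by rewrite /watch_table ea !ifF ?inE //; lia.
exists (2, st); last first.
  apply: (IH l') => //; first by case/andP: st5.
  by apply: (balanced_pop a2 al bl); rewrite ea.
apply: (@watch_step 2 a (z :: st) 2 [::]) => //=.
by rewrite /watch_table ea !ifF ?inE //; lia.
Qed.

(** Up to the first error the stack is the true right stack. If no error occurred, [balanced] and
    the empty left stack at the end would make the right history valid. *)
Lemma watch_invalid x l st : data x -> all (gtn 5) st -> balanced l st ->
  run_stack false x l = Some [::] -> run_stack true x st <> Some [::] ->
  reach watch (rcons x 1) (1, st) (0, [::]).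
Proof.
elim: x l st => [|a x IH] l st /=.
  by move=> _ _ bl [el]; move: bl; rewrite el; case: st.
case/andP=> a2 dx st5 bl; case al: act => [l'|] //= rx.
have := op_symbol true a; case ea: (op true a) => [[] y] /= y4.
  move=> nrx; exists (1, y :: st); last first.
    apply: (IH l') => //=; first by rewrite st5; lia.
    by apply: (balanced_push a2 al bl); rewrite ea.
  have := @watch_step 1 a st 1 (rcons (keep (ohead st)) y) st5 a2.
  rewrite push_keep; apply.
  by rewrite /watch_table ea !ifF ?mem_head //; lia.
case: st st5 bl => [|z st] /= st5 bl nrx.
  exists (3, [::]); last exact: watch_underflow.
  apply: (@watch_step 1 a [::] 3 [::]) => //=.
  by rewrite /watch_table ea !ifF ?inE //; lia.
have st5' : all (gtn 5) st by case/andP: st5.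
have bl' : balanced l' st by apply: (balanced_pop a2 al bl); rewrite ea.
exists (if z == y then 1 else 2, st).
  apply: (@watch_step 1 a (z :: st) _ [::]) => //=.
  have a1 : (a <= 1) = false by lia.
  by rewrite /watch_table ea a1 mem_head.
move: nrx; rewrite /act /=; case: eqP => [_|_] /= nrx; first exact: (IH l').
exact: (watch_mismatch dx st5' bl').
Qed.

(** State 1 does not read the letter 1, so an accepting run must leave it, and it does so only where
    [run_stack] fails. *)
Lemma watch_sound x st : all (leq 2) x ->
  reach watch (rcons x 1) (1, st) (0, [::]) -> run_stack true x st <> Some [::].
Proof.
elim: x st => [|a x IH] st /=.
  move=> _ [c [u]]; rewrite mem_table => /and4P[_ _ _].
  by rewrite /watch_table; case: op.
case/andP=> a2 dx [[q1 s1] [u]]; rewrite mem_table => /and4P[_ _ _].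
rewrite /watch_table /act /=; case: (op true a) => [[] y] /=; rewrite ifF; try lia.
  rewrite inE => /eqP[-> ->] ->; rewrite rev_rcons => r; apply: IH => //.
  by move: r; case: st.
case: st => //= z st; rewrite inE => /eqP[-> ->] /= ->.
by case: ifP => //= _ r; apply: IH.
Qed.

Lemma watch_blocks x :
  (data x -> valid false x -> ~ valid true x -> block_lang watch x) /\
  (block_lang watch x -> ~ valid true x).
Proof.
split=> [dx v1 v2|[x2]].
  split; first by apply: sub_all dx => a /andP[].
  exists (1, [::]); first by exists [::]; rewrite ?mem_table.
  exact: (@watch_invalid x [::]).
case=> [[q1 s1] [u]]; rewrite mem_table => /and4P[_ _ _].
rewrite /= inE => /eqP[-> ->] /= ->.
exact: watch_sound.
Qed.

(** * The nondeterministic observer *)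

Lemma watch_block_transitions : all block_transition (delta watch).
Proof. by vm_compute. Qed.

(** The factorisation of a correct history that leaves the stack [st]: each remaining item is shown
    with the letter that pushed it and the valid word read above it. *)
Fixpoint unmatched (s : bool) (x : seq letter) (st : seq nat) : Prop :=
  if st is y :: st' then exists p a u,
    [/\ x = p ++ a :: u, op s a = (true, y), valid s u & unmatched s p st']
  else valid s x.

Lemma valid_frame s u st : valid s u -> run_stack s u st = Some st.
Proof. exact: run_stack_frame. Qed.

Lemma valid_cat s u v : valid s u -> valid s v -> valid s (u ++ v).
Proof. by rewrite /valid run_stack_cat => -> /=. Qed.

Lemma unmatched_cat s x u st :
  unmatched s x st -> valid s u -> unmatched s (x ++ u) st.
Proof.
case: st => [|y st] /=; first exact: valid_cat.
case=> p [a [v [-> ea vv um]]] vu; exists p, a, (v ++ u).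
by rewrite -catA; split=> //; apply: valid_cat.
Qed.

(** Both errors can be located by counting heights: from the beginning of the word to an underflow,
    or from a push to the pop that should match it. *)
Inductive stack_error (s : bool) (x : seq letter) : Prop :=
| Underflow u a v of x = u ++ a :: v & valid s u & (op s a).1 = false
| Mismatch p a u b v y z of x = p ++ a :: u ++ b :: v & op s a = (true, y) &
    valid s u & op s b = (false, z) & y != z.

(** Read from left to right, a history keeps an [unmatched] factorisation until its first error. At
    the end this is empty, or its top item is never popped. *)
Lemma valid_or_error s x :
  [\/ valid s x, stack_error s x |
      exists p a u, [/\ x = p ++ a :: u, (op s a).1 & valid s u]].
Proof.
suff: stack_error s x \/ exists st, unmatched s x st.
  case=> [|[[|y st]] /=]; [by constructor 2 | by constructor 1 |].
  case=> p [a [u [ex ea vu _]]].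
  by constructor 3; exists p, a, u; rewrite ea.
elim/last_ind: x => [|x b [err|[st um]]]; first by right; exists [::].
  left; rewrite -cats1; case: err => [u a v|p a u c v y z] ->.
    by move=> vu ea; apply: (@Underflow _ _ u a (v ++ [:: b])) => //; rewrite -catA.
  move=> ea vu ec yz; apply: (@Mismatch _ _ p a u c (v ++ [:: b]) y z) => //.
  by rewrite -catA /= -catA.
case eb: (op s b) => [[] z].
  by right; exists (z :: st); exists x, b, [::]; rewrite cats1.
case: st um => [|y st] /= um.
  by left; apply: (@Underflow _ _ x b [::]) => //; rewrite ?cats1 ?eb.
case: um => p [a [u [ex ea vu um]]].
have [ey|yz] := eqVneq y z; last first.
  left; apply: (@Mismatch _ _ p a u b [::] y z) => //.
  by rewrite -cats1 ex -catA.
right; exists st; rewrite ex -cats1 -catA; apply: unmatched_cat um _.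
rewrite /valid /= ea /= run_stack_cat (valid_frame _ vu) /= eb /act /=.
by rewrite ey eqxx.
Qed.

(* On reading 0, guesses an error on the stack [s = ~~ odd q]: an underflow
   (q = 3, 4), or an item that is popped by the wrong letter (q = 5, 6) or
   never popped (q = 7, 8). State 1 waits for the letter that pushes this item,
   and 2 follows a confirmed error. The symbol 4 counts the items that are
   above the relevant one. *)
Definition guess_table (q : state) (a : letter) (X : option stack_symbol) :
    seq (state * seq stack_symbol) :=
  let: (push, y) := op (~~ odd q) a in
  if q == 0 then
    if (a == 0) && (X == None) then [:: (1, [::]); (3, [::]); (4, [::])] else [::]
  else if a == 0 then [::]
  else if a == 1 then
    if (q \in [:: 2; 7; 8]) && (X == None) then [:: (0, [::])] else [::]
  else if q == 1 then
    if X == None then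
      (1, [::]) :: flatten [seq if (op s a).1 then
        [:: (5 + s, [:: (op s a).2]); (7 + s, [::])] else [::] | s <- [:: false; true]]
    else [::]
  else if q == 2 then if X == None then [:: (2, [::])] else [::]
  else if push then [:: (q, rcons (keep X) 4)]
  else if X is Some x then
    if x == 4 then [:: (q, [::])]
    else if (q \in [:: 5; 6]) && (x != y) then [:: (2, [::])] else [::]
  else if q \in [:: 3; 4] then [:: (2, [::])] else [::].

Definition guess : pda.
Proof.
refine (@Pda alphabet symbols (iota 0 9) [:: 0] (table 9 guess_table) [:: 0] _ _ _).
- abstract by move=> q; rewrite !inE => ->.
- abstract by vm_compute.
- abstract by move=> q; rewrite !inE => ->.
Defined.

Lemma guess_block_transitions : all block_transition (delta guess).
Proof. by vm_compute. Qed.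

Lemma guess_step q a st q' u : all (gtn 5) st -> a < 16 ->
  (q < 9) && ((q', u) \in guess_table q a (ohead st)) ->
  hstep guess a (q, st) (q', rev u ++ behead st).
Proof.
move=> st5 a2 /andP[q4 gt]; exists u => //=.
by rewrite mem_table q4 top_in_tops // mem_iota /= a2.
Qed.

Lemma guess_skip x : data x -> reach guess x (1, [::]) (1, [::]).
Proof.
elim: x => [//|a x IH] /= /andP[a2 /IH r]; exists (1, [::]) => //.
apply: (@guess_step 1 a [::] 1 [::]) => //=; first by lia.
rewrite /guess_table; case: op => push y /=.
by do 2?[case: a a2 => [|a] a2 //]; rewrite mem_head.
Qed.

Lemma guess_confirmed x : data x -> reach guess (rcons x 1) (2, [::]) (0, [::]).
Proof.
elim: x => [_|a x IH /= /andP[a2 dx]] /=.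
  by exists (0, [::]) => //; exists [::]; rewrite ?mem_table.
exists (2, [::]); last exact: IH.
apply: (@guess_step 2 a [::] 2 [::]) => //=; first by lia.
rewrite /guess_table; case: op => push y /=.
by do 2?[case: a a2 => [|a] a2 //].
Qed.

Lemma guess_tableE q a X push y : 2 < q < 9 -> 1 < a -> op (~~ odd q) a = (push, y) ->
  guess_table q a X =
  if push then [:: (q, rcons (keep X) 4)]
  else if X is Some x then
    if x == 4 then [:: (q, [::])]
    else if (q \in [:: 5; 6]) && (x != y) then [:: (2, [::])] else [::]
  else if q \in [:: 3; 4] then [:: (2, [::])] else [::].
Proof.
by move=> q2 a1 ea; rewrite /guess_table ea !ifN_eq //; lia.
Qed.

(** Each item of the simulated stack is represented by one symbol 4; [base] stays untouched
    below. *)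
Lemma guess_height q s u st st' base : data u -> 2 < q < 9 -> s = ~~ odd q ->
  all (gtn 5) base -> run_stack s u st = Some st' ->
  reach guess u (q, nseq (size st) 4 ++ base) (q, nseq (size st') 4 ++ base).
Proof.
move=> + q2 es b5; elim: u st => [|a u IH] st /=; first by move=> _ [->].
case/andP=> a2 du; have st5 n : all (gtn 5) (nseq n 4 ++ base).
  by rewrite all_cat b5 all_nseq orbT.
rewrite /act; case ea: (op s a) => [[] y] /=.
  move/(IH (y :: st) du) => r; eexists; last exact: r.
  rewrite -[nseq (size (_ :: _)) _ ++ base]/(4 :: nseq (size st) 4 ++ base) -push_keep.
  apply: guess_step => //; first by lia.
  rewrite es in ea; rewrite (guess_tableE _ q2 _ ea) /= ?mem_head; lia.
case: st => [|z st] //=; case: eqP => //= _ /(IH _ du) r.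
eexists; last exact: r.
apply: (@guess_step q a (4 :: nseq (size st) 4 ++ base) q [::]).
- exact: (st5 (size st).+1).
- by lia.
rewrite es in ea; rewrite (guess_tableE _ q2 _ ea) /= ?mem_head; lia.
Qed.

Lemma guess_error s x : data x -> stack_error s x -> reach guess (block x) (0, [::]) (0, [::]).
Proof.
move=> dx [u a v ex vu ea|p a u b v y z ex ea vu eb yz]; move: dx; rewrite ex.
  rewrite /data all_cat /= => /and3P[du a2 dv].
  have q2 : 2 < 3 + s < 9 by case: (s).
  have es : s = ~~ odd (3 + s) by case: (s).
  exists (3 + s, [::]).
    by apply: (@guess_step 0 0 [::] (3 + s) [::]); rewrite //; case: (s).
  rewrite rcons_cat; apply/reach_cat; exists (3 + s, [::]).
    exact: (guess_height (base := [::]) du q2 es _ vu).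
  exists (2, [::]); last exact: guess_confirmed.
  apply: (@guess_step (3 + s) a [::] 2 [::]) => //; first by lia.
  case oa: (op s a) ea => [push y] /= ea; rewrite ea in oa.
  by rewrite es in oa; rewrite (guess_tableE _ q2 _ oa) /=; case: (s) => //; lia.
rewrite /data all_cat /= all_cat /= => /and5P[dp a2 du b2 dv].
have q2 : 2 < 5 + s < 9 by case: (s).
have es : s = ~~ odd (5 + s) by case: (s).
(* So the remembered symbol is never confused with the counter symbol 4. *)
have y4 : y < 4 by have := op_symbol s a; rewrite ea.
exists (1, [::]); first by apply: (@guess_step 0 0 [::] 1 [::]).
rewrite rcons_cat; apply/reach_cat; exists (1, [::]); first exact: guess_skip.
exists (5 + s, [:: y]).
  apply: (@guess_step 1 a [::] (5 + s) [:: y]) => //; first by lia.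
  rewrite /guess_table; case: (op (~~ _) _) => ? ? /=.
  by rewrite !ifN_eq; try lia; case: (s) ea => ->; case: op => -[] ? /=;
    rewrite !inE eqxx ?orbT.
rewrite rcons_cat; apply/reach_cat; exists (5 + s, [:: y]).
  apply: (guess_height (base := [:: y]) du q2 es _ vu).
  by rewrite /= andbT; lia.
exists (2, [::]); last exact: guess_confirmed.
apply: (@guess_step (5 + s) b [:: y] 2 [::]) => //; try by rewrite /= ?andbT; lia.
rewrite es in eb; rewrite (guess_tableE _ q2 _ eb) /=; last by lia.
by rewrite ifN_eq ?yz; [case: (s) | lia].
Qed.

Lemma guess_leftover s x p a u : data x -> x = p ++ a :: u -> (op s a).1 ->
  valid s u -> reach guess (block x) (0, [::]) (0, [::]).
Proof.
move=> + ex ea vu; rewrite ex /data all_cat /= => /and3P[dp a2 du].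
have q2 : 2 < 7 + s < 9 by case: (s).
have es : s = ~~ odd (7 + s) by case: (s).
exists (1, [::]); first by apply: (@guess_step 0 0 [::] 1 [::]).
rewrite rcons_cat; apply/reach_cat; exists (1, [::]); first exact: guess_skip.
exists (7 + s, [::]).
  apply: (@guess_step 1 a [::] (7 + s) [::]) => //; first by lia.
  rewrite /guess_table; case: (op (~~ _) _) => ? ? /=.
  by rewrite !ifN_eq; try lia; case: (s) ea => ->; case: op => -[] ? /=;
    rewrite !inE eqxx ?orbT.
rewrite -cats1; apply/reach_cat; exists (7 + s, [::]).
  exact: (guess_height (base := [::]) du q2 es _ vu).
exists (0, [::]) => //.
apply: (@guess_step (7 + s) 1 [::] 0 [::]) => //.
by rewrite /guess_table; case: (s); case: op.
Qed.
Lemma guess_stepE q a st q' st' : hstep guess a (q, st) (q', st') ->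
  exists2 u, (q', u) \in guess_table q a (ohead st) & st' = rev u ++ behead st.
Proof. by case=> u; rewrite mem_table => /and4P[_ _ _ gu] /= ->; exists u. Qed.

(** Compares two stacks at the height of the guess: [base] lies below the symbols 4 of [guess], and
    [tail] below the corresponding items of the true stack. *)
Definition guess_invariant (q : state) (base tail : seq nat) : Prop :=
  if q < 5 then base = [::] /\ tail = [::]
  else if q < 7 then exists y st, [/\ y < 4, base = [:: y] & tail = y :: st]
  else base = [::] /\ tail <> [::].

(** While the history is correct, the symbols 4 match the items [v] above [tail]. A pop below them
    exposes an underflow or a mismatch; it is impossible in states 7 and 8, so there [tail] is left
    over at the end. *)
Lemma guess_error_sound q s x base tail v : all (leq 2) x ->
  2 < q < 9 -> s = ~~ odd q -> guess_invariant q base tail ->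
  reach guess (rcons x 1) (q, nseq (size v) 4 ++ base) (0, [::]) ->
  run_stack s x (v ++ tail) <> Some [::].
Proof.
move=> + q2 es inv; elim: x v => [|a x IH] v /=.
  move=> _ [[q1 s1] /guess_stepE[u]].
  rewrite /guess_table; case: op => push y; rewrite ifN_eq; last by lia.
  rewrite /=; case: ifP => // /andP[q7]; move: inv; rewrite /guess_invariant.
  have -> : q < 5 = false by move: q7; rewrite !inE; lia.
  have -> : q < 7 = false by move: q7; rewrite !inE; lia.
  by case=> ->; case: v tail => [|z v] [].
case/andP=> a1 dx [[q1 s1] /guess_stepE[u]].
case ea: (op s a) => [push y]; have ea' := ea; rewrite es in ea'.
rewrite (guess_tableE _ q2 a1 ea') /act /= => {ea'}; case: push ea => ea.
  by rewrite inE => /eqP[-> ->]; rewrite push_keep => -> /(IH (y :: v) dx).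
case: v => [|z v] /=; last first.
  rewrite inE => /eqP[-> ->] -> r; case: eqP => // _; exact: IH dx r.
move: inv; rewrite /guess_invariant; case: ifP => [q5 [-> ->] //|q5].
case: ifP => [q7 [y0 [st [y4 -> ->]]] /=|q7 [-> _] /=].
  rewrite ifN_eq; last by lia.
  by case: ifP => // /andP[_ /negPf->].
by rewrite ifN //; rewrite !inE; lia.
Qed.

Lemma guess_tableE1 a : 1 < a -> guess_table 1 a None =
  (1, [::]) :: flatten [seq if (op s a).1 then
    [:: (5 + s, [:: (op s a).2]); (7 + s, [::])] else [::] | s <- [:: false; true]].
Proof.
by move=> a1; rewrite /guess_table; case: op => push y; rewrite !ifN_eq //; lia.
Qed.

Lemma guess_wait a q' st' : 1 < a -> hstep guess a (1, [::]) (q', st') ->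
  (q', st') = (1, [::]) \/ exists2 s, (op s a).1 &
    (q', st') = (5 + s, [:: (op s a).2]) \/ (q', st') = (7 + s, [::]).
Proof.
move=> a1 /guess_stepE[u + ->]; rewrite [ohead _]/= guess_tableE1 // [behead _]/=.
rewrite in_cons => /orP[/eqP[-> ->]|]; first by left.
case/flatten_mapP=> s _; case: ifP => // ps; rewrite !inE => ins.
by right; exists s => //; case/orP: ins => /eqP[-> ->]; [left | right].
Qed.

Lemma guess_sound x (st : bool -> seq nat) : all (leq 2) x ->
  reach guess (rcons x 1) (1, [::]) (0, [::]) ->
  ~ forall s, run_stack s x (st s) = Some [::].
Proof.
elim: x st => [|a x IH] st /=.
  by move=> _ [[q1 s1] /guess_stepE[u]]; rewrite /guess_table; case: op.
case/andP=> a1 dx [[q1 s1] /(guess_wait a1)[[-> ->]|[s ps gs]]] r rx.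
  (* While waiting, both stacks advance together; the default [[::]] does not occur, since neither
     history fails. *)
  apply: (IH (fun s => odflt [::] (act (op s a) (st s)))) => // s.
  by move: (rx s); case: act.
have := rx s; rewrite /act ps /=; case: gs r => -[-> ->] r.
  apply: (@guess_error_sound (5 + s) s x [:: (op s a).2] ((op s a).2 :: st s) [::]) => //.
  - by case: (s).
  - by case: (s).
  - have [s5 s7] : (5 + s < 5) = false /\ 5 + s < 7 by case: (s).
    by rewrite /guess_invariant s5 s7; exists (op s a).2, (st s); rewrite op_symbol.
apply: (@guess_error_sound (7 + s) s x [::] (_ :: _) [::]) => //; by case: (s).
Qed.

Lemma guess_blocks x : (data x -> ~ (valid false x /\ valid true x) ->
    block_lang guess x) /\
  (block_lang guess x -> ~ (valid false x /\ valid true x)).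
Proof.
split=> [dx nv|[x2 [[q1 s1] /guess_stepE[u + ->]]]].
  split; first by apply: sub_all dx => a /andP[].
  have aux s : ~ valid s x -> reach guess (block x) (0, [::]) (0, [::]).
    case: (valid_or_error s x) => [//|err _|[p [a [u [ex ea vu]]]] _].
      exact: guess_error err.
    exact: guess_leftover ex ea vu.
  have [v1|] := pselect (valid false x); last exact: aux.
  by apply: (aux true) => v2; apply: nv.
rewrite /guess_table; case: op => push y /=; rewrite !inE.
case/or3P=> /eqP[-> ->] /= r [v1 v2].
- by apply: (guess_sound (st := fun => [::]) x2 r) => -[].
- by apply: (@guess_error_sound 3 false x [::] [::] [::]) v1.
- by apply: (@guess_error_sound 4 true x [::] [::] [::]) v2.
Qed.

(** * Counter machines on a tape *)

Inductive instr := INC of nat & nat | DEC of nat & nat & nat.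

Definition reg (i : instr) : nat :=
  match i with INC r _ => r | DEC r _ _ => r end.

Definition upd (rho : nat -> nat) (r v : nat) : nat -> nat :=
  fun r' => if r' == r then v else rho r'.

Definition mconfig : Type := nat * (nat -> nat).

Definition mstep (cd : seq instr) (c : mconfig) : option mconfig :=
  match onth cd c.1 with
  | Some (INC r l) => Some (l, upd c.2 r (c.2 r).+1)
  | Some (DEC r l l') =>
      if c.2 r is n.+1 then Some (l, upd c.2 r n) else Some (l', c.2)
  | None => None
  end.

Inductive msteps (cd : seq instr) : nat -> mconfig -> mconfig -> Prop :=
| msteps0 c : msteps cd 0 c c
| mstepsS n c c1 c' : mstep cd c = Some c1 -> msteps cd n c1 c' -> msteps cd n.+1 c c'.

Lemma msteps_cat cd n n' c c1 c' :
  msteps cd n c c1 -> msteps cd n' c1 c' -> msteps cd (n + n') c c'.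
Proof. by elim=> // m d d1 d' st _ IH /IH; apply: mstepsS. Qed.

Definition input (e : nat) : nat -> nat := upd (fun=> 0) 0 e.

(** Halting means reaching the address [size cd] exactly; a machine that stops at a larger address
    does not halt. *)
Definition halts (cd : seq instr) (e : nat) : Prop :=
  exists n rho, msteps cd n (0, input e) (size cd, rho).

(* The tape holds, from right to left, a separator and then sections ended by
   separators; the value of register [r] is the number of marks in section
   [r], that is with [r.+1] separators to their right. [k] separators follow
   [s]. *)
Fixpoint seps (s : seq nat) : nat := if s is z :: s' then (z == 2) + seps s' else 0.

Lemma seps_cat u v : seps (u ++ v) = seps u + seps v.
Proof. by elim: u => //= z u ->; rewrite addnA. Qed.

Lemma seps_rev s : seps (rev s) = seps s.
Proof. by elim: s => //= z s IH; rewrite rev_cons -cats1 seps_cat IH /= addn0 addnC. Qed.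

Lemma seps_nseq n y : seps (nseq n y) = (y == 2) * n.
Proof. by elim: n => [|n IH] /=; rewrite ?muln0 // IH mulnS. Qed.

Fixpoint cells (y k : nat) (s : seq nat) (r : nat) : nat :=
  if s is z :: s' then ((z == y) && (k + seps s' == r.+1)) + cells y k s' r
  else 0.

Definition regs (s : seq nat) : nat -> nat := cells 1 0 s.

Lemma cells_cat y k u v r :
  cells y k (u ++ v) r = cells y (k + seps v) u r + cells y k v r.
Proof.
by elim: u => [|z u IH] //=; rewrite IH seps_cat addnA (addnC (seps u)) !addnA.
Qed.

Lemma cells_absent y k s r : y \notin s -> cells y k s r = 0.
Proof.
by elim: s => //= z s IH; rewrite inE negb_or eq_sym => /andP[/negPf-> /IH].
Qed.

Lemma cells_many y k s r : r.+1 < k -> cells y k s r = 0.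
Proof. by move=> rk; elim: s => //= z s ->; rewrite addn0; lia. Qed.

Lemma cells_few y k s r : k + seps s <= r -> cells y k s r = 0.
Proof. by elim: s => //= z s IH le; rewrite IH ?addn0; lia. Qed.

(* The states of the control: between blocks, at the beginning of a block,
   entering the input (which [i] more marks will complete), entering the [j]-th
   section, simulating instruction [p] with [j] separators to the right of the
   head, entering from the left the section that instruction [p] acts upon, and
   erasing the tape. *)
Inductive ctl :=
| Between | Start | Chain of nat | Fill of nat | Norm of nat & nat | Test of nat | Erase.

Definition ctl_code (c : ctl) : nat * nat * nat :=
  match c with
  | Between => (0, 0, 0) | Start => (1, 0, 0) | Chain i => (2, i, 0)
  | Fill j => (3, j, 0) | Norm p j => (4, p, j) | Test p => (5, p, 0)
  | Erase => (6, 0, 0)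
  end.

Definition ctl_decode (t : nat * nat * nat) : ctl :=
  let: (k, p, j) := t in
  match k with
  | 0 => Between | 1 => Start | 2 => Chain p | 3 => Fill p | 4 => Norm p j
  | 5 => Test p | _ => Erase
  end.

Lemma ctl_codeK : cancel ctl_code ctl_decode. Proof. by case. Qed.

HB.instance Definition _ := Equality.copy ctl (can_type ctl_codeK).

Section Control.

Variables (cd : seq instr) (K e : nat).

Definition tests (p j : nat) : bool :=
  if onth cd p is Some i then j == (reg i).+1 else false.

(** The tape is written from right to left: a separator, [e] marks, then [K] separators with blanks
    in between. The letters 2 read at [Chain 0] and at [Fill K.+1] mark changes of phase. An
    increment turns the first blank of a section into a mark, a decrement the first mark into a
    blank; a decrement that meets the separator first has found the value 0. *)
Definition ctl_next (c : ctl) (a : letter) : option ctl :=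
  match c with
  | Between => if a == 0 then Some Start else None
  | Start => if a == 4 then Some (Chain e) else None
  | Chain i.+1 => if (a == 3) && (i < e) then Some (Chain i) else None
  | Chain 0 => if a == 2 then Some (Fill 1) else None
  | Fill j =>
      if j <= K then
        if a == 2 then Some (Fill j) else if a == 4 then Some (Fill j.+1) else None
      else if (j == K.+1) && (a == 2) then Some (Norm 0 j) else None
  | Norm p j =>
      if (p <= size cd) && (j <= K.+1) then
        if a \in [:: 8; 9; 13; 14] then Some (Norm p j)
        else if a == 15 then Some (Norm p j.+1)
        else if (a == 10) && (0 < j) then
          Some (if tests p j.-1 then Test p else Norm p j.-1)
        else if (a \in [:: 5; 6; 7]) && (p == size cd) then Some Erase
        else None
      else None
  | Test p =>
      match onth cd p with
      | Some (INC r l) =>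
          if a == 9 then Some (Test p)
          else if a == 11 then Some (Norm l r.+1) else None
      | Some (DEC r l l') =>
          if a == 8 then Some (Test p)
          else if a == 12 then Some (Norm l r.+1)
          else if a == 10 then Some (Norm l' r) else None
      | None => None
      end
  | Erase =>
      if a == 1 then Some Between
      else if a \in [:: 5; 6; 7] then Some Erase else None
  end.

Fixpoint ctl_path (x : seq letter) (c c' : ctl) : Prop :=
  if x is a :: x' then if ctl_next c a is Some c1 then ctl_path x' c1 c' else False
  else c = c'.

Lemma ctl_path_cat x y c c1 c' :
  ctl_path x c c1 -> ctl_path y c1 c' -> ctl_path (x ++ y) c c'.
Proof.
by elim: x c => [|a x IH] c /=; [move=> -> | case: ctl_next => // d; apply: IH].
Qed.

Lemma ctl_next_letter c a c' : ctl_next c a = Some c' ->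
  [\/ [/\ c = Between, a = 0 & c' = Start], [/\ c = Erase, a = 1 & c' = Between] |
      [/\ c <> Between, 1 < a < 16 & c' <> Between]].
Proof.
case: c => [||[|i]|j|p j|p|] /=.
- by case: eqP => // -> [<-]; constructor 1.
- by case: eqP => // -> [<-]; constructor 3.
- by case: eqP => // -> [<-]; constructor 3.
- by case: andP => // -[/eqP-> _] [<-]; constructor 3.
- case: ifP => _; last first.
    by case: andP => // -[_ /eqP->] [<-]; constructor 3.
  case: eqP => [->|_]; first by case=> <-; constructor 3.
  by case: eqP => // -> [<-]; constructor 3.
- case: ifP => // _; case: ifP => [|_].
    by rewrite !inE => a4 [<-]; constructor 3; split=> //; lia.
  case: eqP => [->|_]; first by case=> <-; constructor 3.
  case: andP => [[/eqP-> _]|_]; first by case=> <-; constructor 3; case: ifP.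
  case: andP => // -[]; rewrite !inE => a3 _ [<-].
  by constructor 3; split=> //; lia.
- case: onth => // -[r l|r l l'].
    do 2?[case: eqP => [->|_]; first by case=> <-; constructor 3].
    by [].
  do 3?[case: eqP => [->|_]; first by case=> <-; constructor 3].
  by [].
case: eqP => [->|_]; first by case=> <-; constructor 2.
case: ifP => //; rewrite !inE => a3 [<-].
by constructor 3; split=> //; lia.
Qed.

(** * From valid histories to halting runs *)

Definition left_tape (s l : seq nat) : Prop :=
  (exists m, s = l ++ nseq m 3) /\ 3 \notin l.

Lemma left_tape_push y s l : y != 3 -> left_tape s l -> left_tape (y :: s) (y :: l).
Proof. by move=> y3 [[m ->] l3]; split; [exists m | rewrite inE negb_or eq_sym y3]. Qed.

Lemma left_tape_pop y s l : y != 3 -> left_tape (y :: s) l ->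
  exists2 l', l = y :: l' & left_tape s l'.
Proof.
move=> y3 [[m]]; case: l => [|z l] /=.
  by case: m => // m [ey]; rewrite ey in y3.
case=> <- ->; rewrite inE negb_or => /andP[_ l3]; exists l => //.
by split=> //; exists m.
Qed.

(** [l] is the tape to the left of the head, and [n] counts the simulated steps. In [Test], [z] has
    been crossed since the separator that opens the section; for a decrement it is blank, which
    shows the register to be 0 if the next separator is met. At [Erase] halting is already
    established. *)
Definition invariant (c : ctl) (s1 s2 : seq nat) : Prop :=
  match c with
  | Between => False
  | Start => s1 = [::] /\ s2 = [::]
  | Chain i => [/\ all (pred1 3) s1, seps s2 = 1 &
      forall r, regs s2 r + (r == 0) * i = input e r]
  | Fill j => [/\ all (pred1 3) s1, seps s2 = j & regs s2 = input e]
  | Norm p j => exists l n, [/\ left_tape s1 l, seps s2 = j,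
      seps l + j = K.+1 & msteps cd n (0, input e) (p, regs (rev l ++ s2))]
  | Test p => exists z l n, [/\ left_tape s1 (z ++ 2 :: l),
      tests p (seps s2), seps (z ++ 2 :: l) + seps s2 = K.+1,
      msteps cd n (0, input e) (p, regs (rev (z ++ 2 :: l) ++ s2)) &
      if onth cd p is Some (DEC _ _ _) then all (pred1 0) z else true]
  | Erase => halts cd e
  end.

Lemma all_pred1_nseq (s : seq nat) y : all (pred1 y) s -> exists m, s = nseq m y.
Proof. by move=> sy; exists (size s); apply/all_pred1P. Qed.

Lemma regs_mark l s : regs (rev l ++ 1 :: s) =
  fun r => regs (rev l ++ 0 :: s) r + (seps s == r.+1).
Proof. by apply/funext => r; rewrite /regs !cells_cat /=; lia. Qed.

(** The section of [r] lies between the two displayed separators. *)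
Lemma regs_section0 z t s r : all (pred1 0) z -> seps (2 :: s) = r.+1 ->
  regs (rev (z ++ 2 :: t) ++ 2 :: s) r = 0.
Proof.
move=> z0; rewrite /regs rev_cat rev_cons cat_rcons cells_cat /= => cr.
have z1 : 1 \notin rev z by rewrite mem_rev; apply/negP => /(allP z0).
by rewrite cells_cat /= (cells_absent _ _ z1) cells_many ?cells_few //=; lia.
Qed.

(** During the simulation most letters only move the head. A machine step is counted where [Test] is
    left. *)
Lemma invariant_step c a c' s1 s2 s1' s2' : ctl_next c a = Some c' -> 1 < a ->
  act (op false a) s1 = Some s1' -> act (op true a) s2 = Some s2' ->
  invariant c s1 s2 -> invariant c' s1' s2'.
Proof.
case: c => [||[|i]|j|p j|p|] /=.
- by case: eqP => // ->.
- case: eqP => // -> [<-] _ [<-] [<-] [-> ->]; split=> // r.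
  by rewrite /input /upd /regs; case: r => [|r] /=; lia.
- case: eqP => // -> [<-] _ [<-] [<-] [s3 s2c sr]; split=> //.
  by apply/funext => r; rewrite -sr /regs /= muln0 addn0.
- case: andP => // -[/eqP-> _] [<-] _ [<-] [<-] [s3 s2c sr]; split=> // r.
  by rewrite -sr /regs /= s2c; lia.
- case: ifP => _; last first.
    case: andP => // -[/eqP ej /eqP->] [<-] _ [<-] [<-] [s3 s2c sr].
    exists [::], 0; have [m ->] := all_pred1_nseq s3; split=> //.
    + by split=> //; exists m.+1.
    + by rewrite /= -sr; apply: msteps0.
  case: eqP => [->|_].
    by case=> <- _ [<-] [<-] [s3 s2c sr]; split.
  case: eqP => // -> [<-] _ [<-] [<-] [s3 s2c sr]; split=> //=; lia.
- case: ifP => // _; case: ifP => [|_].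
    rewrite !inE => a4 [<-] _ + + [l [n [lt cj cl ms]]].
    case/or4P: a4 => /eqP->; rewrite /act /op /=.
    + case=> <-; case: s2 cj cl ms => [|z s2] //= cj cl ms.
      case: eqP => // ez [<-]; subst z; exists (0 :: l), n.
      split=> //; first exact: left_tape_push.
      by rewrite rev_cons cat_rcons.
    + case=> <-; case: s2 cj cl ms => [|z s2] //= cj cl ms.
      case: eqP => // ez [<-]; subst z; exists (1 :: l), n.
      split=> //; first exact: left_tape_push.
      by rewrite rev_cons cat_rcons.
    + case: s1 lt => [|z s1] //= lt; case: eqP => // ez [<-] [<-]; subst z.
      have [//|l' el lt'] := left_tape_pop _ lt; subst l.
      exists l', n; split=> //.
      by rewrite rev_cons cat_rcons in ms.
    + case: s1 lt => [|z s1] //= lt; case: eqP => // ez [<-] [<-]; subst z.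
      have [//|l' el lt'] := left_tape_pop _ lt; subst l.
      exists l', n; split=> //.
      by rewrite rev_cons cat_rcons in ms.
  case: eqP => [->|_].
    rewrite /act /op /= => -[<-] _ + + [l [n [lt cj cl ms]]].
    case: s1 lt => [|z s1] //= lt; case: eqP => // ez [<-] [<-]; subst z.
    have [//|l' el lt'] := left_tape_pop _ lt; subst l.
    exists l', n; split=> //=; rewrite ?cj //; first by move: cl => /=; lia.
    by rewrite rev_cons cat_rcons in ms.
  case: andP => [[/eqP-> j0]|_].
    rewrite /act /op /= => -[<-] _ [<-] + [l [n [lt cj cl ms]]].
    case: s2 cj cl ms => [|z s2] //= cj cl ms.
    case: eqP => // ez [<-]; subst z; move: cj => /= cj.
    have cj' : seps s2 = j.-1 by rewrite -cj.
    have lt' := @left_tape_push 2 _ _ isT lt.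
    have ms' : msteps cd n (0, input e) (p, regs (rev (2 :: l) ++ s2)).
      by rewrite rev_cons cat_rcons.
    case: ifP => tp.
      exists [::], l, n; split=> //; first by rewrite cj'.
      + by rewrite /=; lia.
      + by case: onth => [[]|].
    by exists (2 :: l), n; split=> //=; lia.
  case: andP => // -[_ /eqP ep] [<-] _ _ _ [l [n [_ _ _ ms]]].
  by exists n, (regs (rev l ++ s2)); rewrite -ep.
- rewrite /tests.
  case oi: (onth cd p) => [[r l|r l l']|] //=.
    case: eqP => [->|_].
      rewrite /act /op /= => -[<-] _ [<-] + [z [t [n [lt /eqP cr ct ms _]]]].
      case: s2 cr ct ms => [|y s2] //= cr ct ms.
      case: eqP => // ey [<-]; subst y; exists (1 :: z), t, n.
      rewrite /tests oi; split=> //=; [exact: left_tape_push|exact/eqP|].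
      by rewrite rev_cons cat_rcons.
    case: eqP => [->|//].
    rewrite /act /op /= => -[<-] _ [<-] + [z [t [n [lt /eqP cr ct ms _]]]].
    case: s2 cr ct ms => [|y s2] //= cr ct ms.
    case: eqP => // ey [<-]; subst y; exists (1 :: z ++ 2 :: t), n.+1.
    split=> //; [exact: left_tape_push|by rewrite -cr -ct|].
    rewrite -[n.+1]addn1; apply: msteps_cat ms _.
    apply: (mstepsS (c1 := (l, regs (rev (1 :: z ++ 2 :: t) ++ s2)))); last exact: msteps0.
    rewrite /mstep oi; congr (Some (_, _)).
    rewrite rev_cons cat_rcons regs_mark; apply/funext => r' /=; rewrite /upd.
    move: cr => /=; rewrite add0n => ->.
    by rewrite eqSS (eq_sym r); case: eqP => [->|_]; rewrite ?addn1 ?addn0.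
  case: eqP => [->|_].
    rewrite /act /op /= => -[<-] _ [<-] + [z [t [n [lt /eqP cr ct ms z0]]]].
    case: s2 cr ct ms => [|y s2] //= cr ct ms.
    case: eqP => // ey [<-]; subst y; exists (0 :: z), t, n.
    rewrite /tests oi; split=> //=; [exact: left_tape_push|exact/eqP|].
    by rewrite rev_cons cat_rcons.
  case: eqP => [->|_].
    rewrite /act /op /= => -[<-] _ [<-] + [z [t [n [lt /eqP cr ct ms z0]]]].
    case: s2 cr ct ms => [|y s2] //= cr ct ms.
    case: eqP => // ey [<-]; subst y; exists (0 :: z ++ 2 :: t), n.+1.
    split=> //; [exact: left_tape_push|by rewrite -cr -ct|].
    rewrite -[n.+1]addn1; apply: msteps_cat ms _.
    apply: (mstepsS (c1 := (l, regs (rev (0 :: z ++ 2 :: t) ++ s2)))); last exact: msteps0.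
    rewrite /mstep oi regs_mark.
    move: cr => /=; rewrite add0n => ->; rewrite eqxx addn1.
    congr (Some (_, _)).
    rewrite rev_cons cat_rcons; apply/funext => r' /=; rewrite /upd.
    by rewrite eqSS (eq_sym r); case: eqP => [->|_]; rewrite ?addn0.
  (* The separator is met after blanks only, so the register is 0. *)
  case: eqP => [->|//].
  rewrite /act /op /= => -[<-] _ [<-] + [z [t [n [lt /eqP cr ct ms z0]]]].
  case: s2 cr ct ms => [|y s2] //= cr ct ms.
  case: eqP => // ey [<-]; subst y; exists (2 :: z ++ 2 :: t), n.+1.
  split=> //; [exact: left_tape_push|by move: cr => /= []| |].
    by move: ct cr => /=; lia.
  rewrite -[n.+1]addn1; apply: msteps_cat ms _.
  apply: (mstepsS (c1 := (l', regs (rev (2 :: z ++ 2 :: t) ++ s2)))); last exact: msteps0.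
  rewrite /mstep oi rev_cons cat_rcons /=.
  by rewrite regs_section0.
- case: eqP => [->//|_].
  by case: ifP => // _ [<-].
Qed.

Lemma ctl_path_halts x c s1 s2 t1 t2 : all (leq 2) x -> ctl_path x c Erase ->
  run_stack false x s1 = Some t1 -> run_stack true x s2 = Some t2 ->
  invariant c s1 s2 -> halts cd e.
Proof.
elim: x c s1 s2 => [|a x IH] c s1 s2 /=; first by move=> _ ->.
case/andP=> a1 ax; case nc: ctl_next => [c1|//] pc.
case a1E: act => [u1|//] /= r1; case a2E: act => [u2|//] /= r2 inv.
exact: IH ax pc r1 r2 (invariant_step nc a1 a1E a2E inv).
Qed.

(** * From halting runs to valid histories *)

Definition tape_reach (c : ctl) (s1 s2 : seq nat) (c' : ctl) (t1 t2 : seq nat) : Prop :=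
  exists x, [/\ data x, ctl_path x c c', run_stack false x s1 = Some t1
    & run_stack true x s2 = Some t2].

Lemma tape_reach_refl c s1 s2 : tape_reach c s1 s2 c s1 s2.
Proof. by exists [::]. Qed.

Lemma tape_reach_trans c s1 s2 c' s1' s2' c'' t1 t2 :
  tape_reach c s1 s2 c' s1' s2' -> tape_reach c' s1' s2' c'' t1 t2 ->
  tape_reach c s1 s2 c'' t1 t2.
Proof.
case=> x [dx px r1 r2] [y [dy py q1 q2]]; exists (x ++ y).
rewrite /data all_cat !run_stack_cat r1 r2; split=> //; first exact/andP.
exact: ctl_path_cat px py.
Qed.

Lemma tape_step a c s1 s2 c' s1' s2' : 1 < a < 16 -> ctl_next c a = Some c' ->
  act (op false a) s1 = Some s1' -> act (op true a) s2 = Some s2' ->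
  tape_reach c s1 s2 c' s1' s2'.
Proof. by move=> a2 nc a1E a2E; exists [:: a]; rewrite /= a2 nc a1E a2E. Qed.

Lemma tape_left p l b s : p <= size cd -> all (gtn 3) l ->
  seps l + seps s = K.+1 ->
  tape_reach (Norm p (seps s)) (l ++ b) s (Norm p K.+1) b (rev l ++ s).
Proof.
move=> ph; elim: l s => [|z l IH] s; first by move=> _ /= <-; apply: tape_reach_refl.
move=> /= /andP[z3 l3] cs; rewrite rev_cons cat_rcons.
have sK : seps s <= K.+1 by rewrite -cs leq_addl.
apply: tape_reach_trans (IH (z :: s) l3 _); last by rewrite -cs /= addnCA addnA.
(* For a tape symbol [z], the letters [5 + z], [8 + z] and [13 + z] remove it, move right over it
   and move left over it. *)
apply: (@tape_step (13 + z)); try by [lia | case: z z3 {cs} => [|[|[|]]]].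
by case: z z3 {cs} => [|[|[|]]] //= _; rewrite ph sK.
Qed.

Lemma tape_right p i u v b : onth cd p = Some i -> all (gtn 3) u ->
  seps v = (reg i).+1 -> seps (u ++ 2 :: v) <= K.+1 ->
  tape_reach (Norm p (seps (u ++ 2 :: v))) b (u ++ 2 :: v)
    (Test p) (2 :: rev u ++ b) v.
Proof.
move=> op3 + cv; have ph : p <= size cd.
  by rewrite ltnW // -onthTE op3.
elim: u b => [|z u IH] b /=.
  move=> _ cK; apply: (@tape_step 10) => //=.
  by rewrite ph cK /= /tests op3 add0n cv eqxx.
case/andP=> z3 u3 cK; rewrite rev_cons cat_rcons.
apply: tape_reach_trans (IH (z :: b) u3 _); last by apply: leq_trans cK; apply: leq_addl.
apply: (@tape_step (8 + z)); try by [lia | case: z z3 {cK} => [|[|[|]]]].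
case: z z3 cK => [|[|[|]]] //= _ cK; rewrite ?ph ?cK //=.
rewrite /tests op3 add0n seps_cat /= cv.
by case: eqP => //; lia.
Qed.

(** [d] tells whether the copies of [y2] are written on the right stack or consumed there. *)
Lemma tape_repeat c a n y1 y2 d s1 s2 : 1 < a < 16 -> ctl_next c a = Some c ->
  op false a = (true, y1) -> op true a = (d, y2) ->
  tape_reach c s1 (if d then s2 else nseq n y2 ++ s2)
    c (nseq n y1 ++ s1) (if d then nseq n y2 ++ s2 else s2).
Proof.
move=> a2 nc o1 o2; elim: n s1 s2 => [|n IH] s1 s2.
  by case: d {o2}; apply: tape_reach_refl.
have swap y (s : seq nat) : nseq n y ++ y :: s = nseq n.+1 y ++ s.
  by elim: n {IH} => //= n ->.
rewrite -!swap; case: d o2 IH => o2 IH.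
  apply: tape_reach_trans (IH (y1 :: s1) (y2 :: s2)).
  by apply: (@tape_step a); rewrite ?o1 ?o2.
rewrite swap; apply: tape_reach_trans (IH (y1 :: s1) s2).
by apply: (@tape_step a); rewrite ?o1 ?o2 //= /act /= eqxx.
Qed.

Lemma tape_erase s : all (gtn 3) s -> s != [::] ->
  tape_reach (Norm (size cd) K.+1) (nseq (size s) 3) s Erase [::] [::].
Proof.
have er t : all (gtn 3) t -> tape_reach Erase (nseq (size t) 3) t Erase [::] [::].
  elim: t => [_|z t IH /= /andP[z3 /IH]]; first exact: tape_reach_refl.
  apply: tape_reach_trans.
  by apply: (@tape_step (5 + z)); try lia; case: z z3 => [|[|[|]]].
case: s => // z s /= /andP[z3 /er] r _; apply: tape_reach_trans r.
apply: (@tape_step (5 + z)); try lia; case: z z3 => [|[|[|]]] //= _.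
all: by rewrite !leqnn !eqxx.
Qed.

Lemma section_split s r : r.+1 < seps s ->
  exists u v, s = u ++ 2 :: v /\ seps v = r.+1.
Proof.
elim: s => //= z s IH le; have [/IH[u [v [-> cv]]]|ge] := ltnP r.+1 (seps s).
  by exists (z :: u), v.
case: eqP le => [->|_] le; last by rewrite add0n ltnNge ge in le.
by exists [::], s; split=> //; apply/eqP; rewrite eqn_leq ge.
Qed.

Lemma first_blank s r : all (gtn 3) s -> seps s = r.+1 -> 0 < cells 0 0 s r ->
  exists n t, s = nseq n 1 ++ 0 :: t.
Proof.
elim: s => //= z s IH /andP[z3]; case: z z3 => [|[|[|]]] //= _ s3 cs.
- by exists 0, s.
- by rewrite add0n => /(IH s3 cs)[n [t ->]]; exists n.+1, t.
by rewrite cells_few //; lia.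
Qed.

Lemma first_nonblank s : all (gtn 3) s -> 0 < seps s ->
  exists n z t, s = nseq n 0 ++ z :: t /\ (z = 1 \/ z = 2).
Proof.
elim: s => //= z s IH /andP[z3]; case: z z3 => [|[|[|]]] //= _ s3 cs.
- by have [n [z [t [-> ez]]]] := IH s3 cs; exists n.+1, z, t.
- by exists 0, 1, s; split=> //; left.
by exists 0, 2, s; split=> //; right.
Qed.

(** For each instruction the head returns to the left end and then walks to the section concerned. A
    step uses up at most one blank, so [n] blanks per section suffice for [n] steps. The symbols 3
    count the cells of the tape, whose length stays the same, so that it can be erased at the
    end. *)
Lemma tape_simulation n p s rho l t : msteps cd n (p, regs s) (size cd, rho) ->
  (forall q i, onth cd q = Some i -> reg i < K) ->
  s = rev l ++ t -> all (gtn 3) s -> seps s = K.+1 ->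
  (forall r, r < K -> n <= cells 0 0 s r) ->
  tape_reach (Norm p (seps t)) (l ++ nseq (size s) 3) t Erase [::] [::].
Proof.
move=> + cdK; elim: n p s l t => [|n IH] p s l t ms es s3 cK blank.
  have ep : p = size cd by inversion ms.
  have l3 : all (gtn 3) l by move: s3; rewrite es all_cat all_rev => /andP[].
  have ct : seps l + seps t = K.+1 by rewrite -cK es seps_cat seps_rev.
  rewrite {1}ep; apply: tape_reach_trans (tape_left _ (leqnn _) l3 ct) _.
  by rewrite -es; apply: tape_erase => //; case: (s) cK.
have [p1 [rho1 [st ms1]]] : exists p1 rho1,
    mstep cd (p, regs s) = Some (p1, rho1) /\ msteps cd n (p1, rho1) (size cd, rho).
  by inversion ms as [|? ? [p1 rho1]]; exists p1, rho1.
move: st; rewrite /mstep; case oi: (onth cd p) => [i|//] st.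
have ph : p <= size cd by rewrite ltnW // -onthTE oi.
have l3 : all (gtn 3) l by move: s3; rewrite es all_cat all_rev => /andP[].
have ct : seps l + seps t = K.+1 by rewrite -cK es seps_cat seps_rev.
apply: tape_reach_trans (tape_left _ ph l3 ct) _; rewrite -es.
have rK := cdK _ _ oi.
have [u [v [esu cv]]] : exists u v, s = u ++ 2 :: v /\ seps v = (reg i).+1.
  by apply: section_split; rewrite cK.
have u3 : all (gtn 3) u by move: s3; rewrite esu all_cat => /andP[].
have v3 : all (gtn 3) v by move: s3; rewrite esu all_cat => /and3P[].
have := @tape_right p i u v (nseq (size s) 3) oi u3 cv.
rewrite -esu cK => /(_ (leqnn _)) r; apply: tape_reach_trans r _.
(* No cell of [u] belongs to the section, so its blanks all lie in [v]. *)
have blank_v : n < cells 0 0 v (reg i).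
  have := blank _ rK; rewrite esu cells_cat /= cells_many //.
  by rewrite /= cv; lia.
have split_s m y z w : v = nseq m y ++ z :: w ->
    s = rev (nseq m y ++ 2 :: rev u) ++ z :: w.
  by move=> ev; rewrite esu ev rev_cat rev_cons revK rev_nseq cat_rcons -catA.
set b := nseq (size s) 3.
case: i oi st rK cv blank_v => [r p'|r p' p''] oi st /= rK cv blank_v.
  case: st => ep1 erho1; subst p1 rho1.
  have [m [w ev]] := first_blank v3 cv (leq_ltn_trans (leq0n _) blank_v).
  have es' := split_s _ _ _ _ ev.
  have cw : seps w = r.+1 by move: cv; rewrite ev seps_cat seps_nseq /=.
  rewrite ev; apply: (tape_reach_trans (c' := Norm p' r.+1)
      (s1' := 1 :: nseq m 1 ++ 2 :: rev u ++ b) (s2' := w)).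
    have n9 : ctl_next (Test p) 9 = Some (Test p) by rewrite /= oi.
    have := @tape_repeat (Test p) 9 m 1 1 false (2 :: rev u ++ b) (0 :: w) isT n9 erefl erefl.
    move/tape_reach_trans; apply.
    by apply: (@tape_step 11) => //; rewrite /= oi.
  set l0 := nseq m 1 ++ 2 :: rev u in es'.
  have -> : 1 :: nseq m 1 ++ 2 :: rev u ++ b = (1 :: l0) ++ b by rewrite /= /l0 -catA.
  have -> : b = nseq (size (rev (1 :: l0) ++ w)) 3.
    by rewrite /b es'; congr (nseq _ 3); rewrite !size_cat !size_rev /=; lia.
  rewrite -cw; apply: (IH p'); rewrite ?rev_cons ?cat_rcons //.
  - rewrite regs_mark; suff <- : upd (regs s) r (regs s r).+1 =
        fun r' => regs (rev l0 ++ 0 :: w) r' + (seps w == r'.+1) by [].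
    apply/funext => r'; rewrite -es' /upd cw eqSS (eq_sym r).
    by case: eqP => [->|_]; rewrite ?addn1 ?addn0.
  - by move: s3; rewrite es' !all_cat.
  - by rewrite -cK es' !seps_cat.
  move=> r' r'K; have := blank _ r'K.
  by rewrite es' !cells_cat /=; lia.
have [m [z [w [ev ez]]]] : exists m z w, v = nseq m 0 ++ z :: w /\ (z = 1 \/ z = 2).
  by apply: first_nonblank; rewrite ?cv.
have es' := split_s _ _ _ _ ev.
have := @tape_repeat (Test p) 8 m 0 0 false (2 :: rev u ++ b) (z :: w) isT.
rewrite /= oi => /(_ erefl erefl erefl); rewrite -ev => /tape_reach_trans; apply.
set l0 := nseq m 0 ++ 2 :: rev u in es'.
have -> : nseq m 0 ++ 2 :: rev u ++ b = l0 ++ b by rewrite /l0 -catA.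
case: ez => ez; subst z.
  have cw : seps w = r.+1 by move: cv; rewrite ev seps_cat seps_nseq /=.
  have rs : regs s r = (regs (rev l0 ++ 0 :: w) r).+1.
    by rewrite es' regs_mark cw eqxx addn1.
  rewrite /= rs in st; case: st => ep1 erho1; subst p1 rho1.
  apply: (tape_reach_trans (c' := Norm p' r.+1) (s1' := 0 :: l0 ++ b) (s2' := w)).
    by apply: (@tape_step 12) => //; rewrite /= oi.
  have -> : 0 :: l0 ++ b = (0 :: l0) ++ b by [].
  have -> : b = nseq (size (rev (0 :: l0) ++ w)) 3.
    by rewrite /b es'; congr (nseq _ 3); rewrite !size_cat !size_rev /=; lia.
  rewrite -cw; apply: (IH p'); rewrite ?rev_cons ?cat_rcons //.
  - suff <- : upd (regs s) r (regs (rev l0 ++ 0 :: w) r) = regs (rev l0 ++ 0 :: w) by [].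
    apply/funext => r'; rewrite /upd {1}es' regs_mark cw eqSS (eq_sym r).
    by case: eqP => [->|_]; rewrite ?addn0.
  - by move: s3; rewrite es' !all_cat.
  - by rewrite -cK es' !seps_cat.
  move=> r' r'K; have := blank _ r'K.
  by rewrite es' !cells_cat /=; lia.
have cw : seps w = r by move: cv; rewrite ev seps_cat seps_nseq /= => -[].
have rs : regs s r = 0 by rewrite es' /l0 regs_section0 ?all_nseq ?orbT //= cw.
rewrite /= rs in st; case: st => ep1 erho1; subst p1 rho1.
apply: (tape_reach_trans (c' := Norm p'' r) (s1' := 2 :: l0 ++ b) (s2' := w)).
  by apply: (@tape_step 10) => //; rewrite /= oi.
have es2 : s = rev (2 :: l0) ++ w by rewrite rev_cons cat_rcons.
rewrite -cw; apply: (IH p'' s (2 :: l0)) => // r' r'K; apply: ltnW; exact: blank.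
Qed.

(** The right stack on entering [Fill j.+1], with [n] blanks guessed for each section; the blank
    next to the [e] marks comes from the letter read at [Chain 0]. *)
Fixpoint blank_tape (n j : nat) : seq nat :=
  if j is j'.+1 then 2 :: nseq n 0 ++ blank_tape n j' else 0 :: nseq e 1 ++ [:: 2].

Lemma seps_blank_tape n j : seps (blank_tape n j) = j.+1.
Proof.
by elim: j => [|j IH] /=; rewrite ?seps_cat seps_nseq /= ?IH; lia.
Qed.

Lemma cells_nseq_absent y k n z r : z != y -> cells y k (nseq n z) r = 0.
Proof. by move=> zy; apply: cells_absent; rewrite mem_nseq eq_sym (negPf zy) andbF. Qed.

Lemma cells_nseq y k n r : y != 2 -> cells y k (nseq n y) r = (k == r.+1) * n.
Proof.
move=> y2; elim: n => [|n IH] /=; first by rewrite muln0.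
by rewrite IH eqxx seps_nseq (negPf y2) addn0 mulnS.
Qed.

Lemma regs_blank_tape n j : regs (blank_tape n j) = input e.
Proof.
apply/funext => r; rewrite /regs; elim: j => [|j IH] /=.
  rewrite cells_cat cells_nseq //= /input /upd; case: r => [|r] /=; lia.
by rewrite cells_cat cells_nseq_absent.
Qed.

Lemma cells_blank_tape n j r : r < j -> n <= cells 0 0 (blank_tape n j) r.
Proof.
elim: j => //= j IH; rewrite ltnS leq_eqVlt => /orP[/eqP->|/IH le].
  by rewrite cells_cat cells_nseq // seps_blank_tape eqxx mul1n leq_addr.
by rewrite cells_cat; lia.
Qed.

Lemma blank_tape_lt3 n j : all (gtn 3) (blank_tape n j).
Proof. by elim: j => [|j IH] /=; rewrite all_cat all_nseq /= ?orbT. Qed.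

Lemma tape_fill n j : j <= K ->
  tape_reach Start [::] [::] (Fill j.+1) (nseq (size (blank_tape n j)) 3) (blank_tape n j).
Proof.
elim: j => [_|j IH jK].
  apply: (tape_reach_trans (c' := Chain e) (s1' := [:: 3]) (s2' := [:: 2])).
    exact: (@tape_step 4).
  apply: (tape_reach_trans (c' := Chain 0) (s1' := nseq e 3 ++ [:: 3])
      (s2' := nseq e 1 ++ [:: 2])); last first.
    have -> : nseq (size (blank_tape n 0)) 3 = 3 :: nseq e 3 ++ [:: 3].
      by rewrite /= size_cat size_nseq nseqD.
    exact: (@tape_step 2).
  suff chain i s1 s2 : i <= e ->
      tape_reach (Chain i) s1 s2 (Chain 0) (nseq i 3 ++ s1) (nseq i 1 ++ s2).
    exact: chain.
  elim: i s1 s2 => [|i IHi] s1 s2 ie; first exact: tape_reach_refl.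
  have swap y (s : seq nat) : nseq i.+1 y ++ s = nseq i y ++ y :: s.
    by elim: i {IHi ie} => //= i ->.
  rewrite !swap; apply: tape_reach_trans (IHi (3 :: s1) (1 :: s2) (ltnW ie)).
  by apply: (@tape_step 3); rewrite //= ie.
apply: tape_reach_trans (IH (ltnW jK)) _.
apply: (tape_reach_trans (c' := Fill j.+1)
    (s1' := nseq n 3 ++ nseq (size (blank_tape n j)) 3)
    (s2' := nseq n 0 ++ blank_tape n j)).
  have := @tape_repeat (Fill j.+1) 2 n 3 0 true; apply => //.
  by rewrite /= jK.
have -> : nseq (size (blank_tape n j.+1)) 3 = 3 :: nseq n 3 ++ nseq (size (blank_tape n j)) 3.
  by rewrite /= size_cat size_nseq nseqD.
by apply: (@tape_step 4) => //; rewrite /= jK.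
Qed.

(** A halting run of [n] steps gives a history with [n] blanks in each section; conversely,
    [invariant] extracts a run from a history. *)
Lemma ctl_pathP : (forall p i, onth cd p = Some i -> reg i < K) ->
  halts cd e <->
  exists x, [/\ all (leq 2) x, ctl_path x Start Erase, valid false x & valid true x].
Proof.
move=> cdK; split=> [[n [rho ms]]|[x [ax px v1 v2]]]; last exact: (ctl_path_halts ax px v1 v2).
(* The first cell is the blank written by the letter 2 that ends the filling. *)
pose t := 0 :: blank_tape n K.
suff [x [dx px v1 v2]] : tape_reach Start [::] [::] Erase [::] [::].
  by exists x; split=> //; apply: sub_all dx => a /andP[].
apply: tape_reach_trans (tape_fill n (leqnn K)) _.
apply: (tape_reach_trans (c' := Norm 0 K.+1) (s1' := nseq (size t) 3) (s2' := t)).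
  by apply: (@tape_step 2) => //=; rewrite ltnn eqxx.
have ct : seps t = K.+1 by rewrite /= seps_blank_tape.
rewrite -ct; apply: (@tape_simulation n 0 t rho [::] t) => //.
- suff -> : regs t = input e by [].
  by rewrite -(regs_blank_tape n K).
- exact: blank_tape_lt3.
by move=> r rK; apply: leq_trans (cells_blank_tape n rK) _; rewrite leq_addl.
Qed.

End Control.

(** * The controlling automaton *)

(* [Chain i], on which the input depends, has a number that is easily computed
   from [i], and odd unlike those of the other states. *)
Definition ctl_seq (c : ctl) : seq nat :=
  match c with
  | Between => [::] | Start => [:: 0] | Chain i => [:: 1; i] | Fill j => [:: 2; j]
  | Norm p j => [:: 3; p; j] | Test p => [:: 4; p] | Erase => [:: 5]
  end.

Definition ctl_num (c : ctl) : state :=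
  if c is Chain i then i.*2.+1 else (CodeSeq.code (ctl_seq c)).*2.

Lemma ctl_num_inj : injective ctl_num.
Proof.
have dbl m n : m.*2 = n.*2 -> m = n by lia.
have code_inj s t : (CodeSeq.code s).*2 = (CodeSeq.code t).*2 -> s = t.
  by move=> /dbl /(can_inj CodeSeq.codeK).
case=> [||i|j|p j|p|]; case=> [||i'|j'|p' j'|p'|] //; rewrite /ctl_num;
  try (by move/code_inj => // -[]); try lia.
all: try by move/code_inj => -[] -> // ->.
by move=> [] /dbl ->.
Qed.

Lemma ctl_num_eq0 c : (ctl_num c == 0) = (c == Between).
Proof. by rewrite -(inj_eq ctl_num_inj). Qed.

Section Product.

Variables (cd : seq instr) (K : nat).
(** What the automaton does to its stack depends on the letter and the top symbol alone, so that the
    same control serves for a DFA and for a DPDA. *)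
Variables (gamma : seq stack_symbol).
Variable actions : letter -> seq (option stack_symbol * seq stack_symbol).

Hypothesis actions_wf : all (fun a => all (fun p =>
  (if p.1 is Some x then x \in gamma else true) && all (mem gamma) p.2) (actions a)) alphabet.

Definition edge (c : ctl) (a : letter) (c' : ctl) : seq transition :=
  [seq (ctl_num c, a, p.1, ctl_num c', p.2) | p <- actions a].

(** [Start] and [Chain i.+1] are left out: their outgoing transitions depend on the input. *)
Definition core_states : seq ctl :=
  [:: Between; Erase; Chain 0] ++ map Fill (iota 0 K.+2) ++
  flatten [seq [seq Norm p j | j <- iota 0 K.+2] | p <- iota 0 (size cd).+1] ++
  map Test (iota 0 (size cd)).

(* The transitions that do not depend on the input. *)
Definition core : seq transition :=
  flatten [seq flatten [seq
    if ctl_next cd K 0 c a is Some c' then edge c a c' else [::] | a <- alphabet]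
    | c <- core_states].

(** The list ends in [core], so its code arises from [core_code] by prepending elements. *)
Fixpoint chain (e : nat) : seq transition :=
  if e is e'.+1 then edge (Chain e'.+1) 3 (Chain e') ++ chain e' else core.

Definition product_delta (e : nat) : seq transition :=
  edge Start 4 (Chain e) ++ chain e.

Lemma mem_edge q a X q' u c b c' : (q, a, X, q', u) \in edge c b c' <->
  [/\ q = ctl_num c, a = b, q' = ctl_num c' & (X, u) \in actions a].
Proof.
split=> [/mapP[[Y v] pa [-> -> -> -> ->]] //|[-> -> -> pa]].
by apply/mapP; exists (X, u).
Qed.

Lemma ctl_next_alphabet e c a c' : ctl_next cd K e c a = Some c' -> a \in alphabet.
Proof.
rewrite mem_iota add0n => /ctl_next_letter[[_ ->]|[_ ->]|[_ /andP[]]] //.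
Qed.

Lemma next_core e c a c' : ctl_next cd K e c a = Some c' ->
  [\/ [/\ c = Start, a = 4 & c' = Chain e],
      exists2 i, i < e & [/\ c = Chain i.+1, a = 3 & c' = Chain i] |
      c \in core_states /\ ctl_next cd K 0 c a = Some c'].
Proof.
case: c => [||[|i]|j|p j|p|] /=; try by constructor 3.
- by case: eqP => // -> [<-]; constructor 1.
- by case: andP => // -[/eqP-> ie] [<-]; constructor 2; exists i.
- move=> nc; constructor 3; split=> //.
  rewrite mem_cat; apply/orP; right; rewrite mem_cat; apply/orP; left.
  apply: map_f; rewrite mem_iota; move: nc.
  by case: ifP => [|_]; [lia | case: eqP => //; lia].
- move=> nc; constructor 3; split=> //.
  have /andP[ph jK] : (p <= size cd) && (j <= K.+1) by move: nc; case: ifP.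
  do 2![rewrite mem_cat; apply/orP; right]; rewrite mem_cat; apply/orP; left.
  apply/flatten_mapP; exists p; first by rewrite mem_iota.
  by apply: map_f; rewrite mem_iota.
move=> nc; constructor 3; split=> //.
do 3![rewrite mem_cat; apply/orP; right]; apply: map_f.
by rewrite mem_iota add0n -onthTE; move: nc; case: onth.
Qed.

Lemma start_core : Start \notin core_states.
Proof.
rewrite mem_cat negb_or; apply/andP; split=> //.
rewrite mem_cat negb_or; apply/andP; split; first by apply/mapP => -[].
rewrite mem_cat negb_or; apply/andP; split; last by apply/mapP => -[].
by apply/flatten_mapP => -[p _ /mapP[]].
Qed.

Lemma mem_product q a X q' u e : (q, a, X, q', u) \in product_delta e <->
  exists c c', [/\ q = ctl_num c, q' = ctl_num c', ctl_next cd K e c a = Some c' &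
    (X, u) \in actions a].
Proof.
have coreP : (q, a, X, q', u) \in core <-> exists c c', [/\ q = ctl_num c,
    q' = ctl_num c', c \in core_states, ctl_next cd K 0 c a = Some c' & (X, u) \in actions a].
  split=> [/flatten_mapP[c cs /flatten_mapP[b bA]]|[c [c' [-> -> cs nc pa]]]].
    case nc: ctl_next => [c'|] // /mem_edge[-> eb -> pa].
    by exists c, c'; split=> //; rewrite eb.
  apply/flatten_mapP; exists c => //; apply/flatten_mapP; exists a.
    exact: ctl_next_alphabet nc.
  by rewrite nc; apply/mem_edge.
have chainP : (q, a, X, q', u) \in chain e <-> (exists2 i, i < e &
    (q, a, X, q', u) \in edge (Chain i.+1) 3 (Chain i)) \/ (q, a, X, q', u) \in core.
  elim: (e) => [|n IH] /=; first by split=> [|[[]|]] //; right.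
  rewrite mem_cat; split=> [/orP[ed|/IH[[i le ed]|co]]|[[i]|co]].
  - by left; exists n.
  - by left; exists i => //; apply: ltnW.
  - by right.
  - rewrite ltnS leq_eqVlt => /orP[/eqP->->//|le ed].
    by apply/orP; right; apply/IH; left; exists i.
  by apply/orP; right; apply/IH; right.
rewrite mem_cat; split=> [/orP[/mem_edge[-> -> -> pa]|/chainP[[i ie]|/coreP]]|].
- by exists Start, (Chain e).
- by move/mem_edge=> [-> -> -> pa]; exists (Chain i.+1), (Chain i); rewrite /= ie.
- case=> c [c' [-> -> cs nc pa]]; exists c, c'; split=> //.
  have : c != Start by apply: contraL cs => /eqP->; apply: start_core.
  by case: c nc cs => // -[|i] //= nc cs; rewrite andbF in nc.
case=> c [c' [qE q'E nc pa]]; apply/orP.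
case: (next_core nc) => [[ec ea ec']|[i ie [ec ea ec']]|[cs nc0]].
- by left; apply/mem_edge; rewrite qE q'E ec ec' -ea.
- right; apply/chainP; left; exists i => //.
  by apply/mem_edge; rewrite qE q'E ec ec' -ea.
by right; apply/chainP; right; apply/coreP; exists c, c'.
Qed.

(* This number is itself the input of the machine: the diagonal argument needs no
   other instances. *)
Definition core_code : nat := CodeSeq.code (map code_transition core).

(** In descending order, the code of the list is given by a plain primitive recursion. *)
Fixpoint below (n : nat) : seq nat := if n is n'.+1 then n' :: below n' else [::].

Lemma mem_below m n : (m \in below n) = (m < n).
Proof. by elim: n => //= n IH; rewrite inE IH ltnS [RHS]leq_eqVlt. Qed.

(** A bound computable from [core_code]: the largest number in the chain is [core_code.*2.+1], and
    states in [core] are smaller than [core_code] because a sequence code exceeds its entries. *)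
Definition product_states : seq state := below core_code.*2.+3.

Lemma core_states_lt q a X q' u : (q, a, X, q', u) \in core ->
  q < core_code /\ q' < core_code.
Proof.
move=> /(map_f code_transition); rewrite -/core_code => tc.
have lt := allP (CodeSeq.ltn_code (map code_transition core)) _ tc.
have := CodeSeq.ltn_code [:: q; a; code_bot X; q'; CodeSeq.code u].
case/and5P=> qc _ _ q'c _.
by split; apply: ltn_trans lt.
Qed.

Lemma product_wf :
  all (wf_transition alphabet gamma product_states) (product_delta core_code).
Proof.
apply/allP => -[[[[q a] X] q'] u] pd.
have [c [c' [qE q'E nc pa]]] := proj1 (mem_product _ _ _ _ _ _) pd.
have aA := ctl_next_alphabet nc; have := allP (allP actions_wf _ aA) _ pa.
rewrite /wf_transition aA /= => /andP[-> ->]; rewrite andbT.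
suff [-> ->] : q \in product_states /\ q' \in product_states by [].
rewrite !mem_below; case: (next_core nc) => [[ec ea ec']|[i ie [ec ea ec']]|[cs nc0]].
- by rewrite qE q'E ec ec' /ctl_num /=; lia.
- by rewrite qE q'E ec ec' /ctl_num /=; lia.
have [] := @core_states_lt q a X q' u; last by lia.
apply/flatten_mapP; exists c => //; apply/flatten_mapP; exists a => //.
by rewrite nc0; apply/mem_edge.
Qed.

Lemma between_state : {subset [:: 0] <= product_states}.
Proof. by move=> q; rewrite inE => /eqP->; rewrite mem_below. Qed.

Definition product : pda :=
  @Pda alphabet gamma product_states [:: 0] (product_delta core_code) [:: 0]
    between_state product_wf between_state.

Lemma product_block_transitions : all (fun p => p.1 == None) (actions 0) ->
  all block_transition (delta product).
Proof.
move=> actions0.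
apply/allP => -[[[[q a] X] q'] u] /mem_product[c [c' [-> -> nc pa]]] /=.
rewrite !ctl_num_eq0; case/ctl_next_letter: nc pa => [[-> -> ->]|[-> -> ->] //|].
  by move/(allP actions0) => /= ->.
case=> /eqP/negPf-> /andP[a1 _] /eqP-> _; rewrite ifN_eq ?a1 //; lia.
Qed.

Lemma product_deterministic :
  (forall a X u1 u2, (X, u1) \in actions a -> (X, u2) \in actions a -> u1 = u2) ->
  deterministic product.
Proof.
move=> det; split; first by exists 0.
move=> q a X q1 u1 q2 u2 /mem_product[c1 [c1' [-> -> nc1 pa1]]].
move=> /mem_product[c2 [c2' [/ctl_num_inj ec -> nc2 pa2]]].
by move: nc2; rewrite -ec nc1 (det _ _ _ _ pa1 pa2) => -[->].
Qed.

Fixpoint stack_reach (x : seq letter) (st st' : seq stack_symbol) : Prop :=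
  if x is a :: x' then exists2 u, (ohead st, u) \in actions a &
    stack_reach x' (rev u ++ behead st) st'
  else st = st'.

(** Control and stack ignore each other, so a run is a pair of independent runs. *)
Lemma product_reach x c c' st st' :
  reach product x (ctl_num c, st) (ctl_num c', st') <->
  ctl_path cd K core_code x c c' /\ stack_reach x st st'.
Proof.
elim: x c st => [|a x IH] c st /=.
  by split=> [[/ctl_num_inj -> ->]|[-> ->]].
split=> [[[q1 s1] [u /mem_product[d [d' [/ctl_num_inj <- /= -> nc pa]]] /= ->]]|].
  by rewrite nc => /IH[px sr]; split=> //; exists u.
case nc: ctl_next => [d|] [] // px [u pa sr].
exists (ctl_num d, rev u ++ behead st); last exact/IH.
by exists u => //; apply/mem_product; exists c, d.
Qed.

Lemma product_blocks x : block_lang product x <->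
  [/\ all (leq 2) x, ctl_path cd K core_code x Start Erase &
      stack_reach (block x) [::] [::]].
Proof.
have blockP : ctl_path cd K core_code (block x) Between Between <->
    ctl_path cd K core_code x Start Erase.
  rewrite /block /=; elim: (x) Start => [|a y IH] c /=.
    split=> [|->//]; case nc: ctl_next => [d|//] ed; subst d.
    by case/ctl_next_letter: nc => [[]|[]|[_ /andP[]]].
  by case: ctl_next.
split=> [[x2 /(product_reach _ Between Between)[/blockP px sr]]|[x2 px sr]] //.
by split=> //; apply/(product_reach _ Between Between); split=> //; apply/blockP.
Qed.

End Product.

(** * Stack actions of the two control automata *)

Definition nfa_actions (a : letter) : seq (option stack_symbol * seq stack_symbol) :=
  [:: (None, [::])].

(** The letter 0 puts a marker 3 below the left stack and 1 pops one symbol 3, so a block ends with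
    the empty stack only if the left stack was empty. *)
Definition stack_actions (a : letter) : seq (option stack_symbol * seq stack_symbol) :=
  let: (push, y) := op false a in
  if a == 0 then [:: (None, [:: 3])] else if a == 1 then [:: (Some 3, [::])]
  else if push then [seq (Some x, [:: x; y]) | x <- iota 0 4] else [:: (Some y, [::])].

Lemma stack_reach_nfa x : stack_reach nfa_actions x [::] [::].
Proof. by elim: x => //= a x IH; exists [::]; rewrite ?mem_head. Qed.

Lemma mem_stack_actions a X u : 1 < a -> (X, u) \in stack_actions a <->
  let: (push, y) := op false a in
  if push then exists2 z, z < 4 & X = Some z /\ u = [:: z; y] else X = Some y /\ u = [::].
Proof.
move=> a1; rewrite /stack_actions; case: op => p y; rewrite !ifN_eq; try lia.
case: p; last by rewrite inE; split=> [/eqP[-> ->]|[-> ->]].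
split=> [/mapP[z]|[z z4 [-> ->]]]; first by rewrite mem_iota => z4 [-> ->]; exists z.
by apply: map_f; rewrite mem_iota.
Qed.

Lemma stack_reach_rcons x st : all (leq 2) x -> all (gtn 4) st ->
  stack_reach stack_actions (rcons x 1) (rcons st 3) [::] <->
  run_stack false x st = Some [::].
Proof.
have s1 : stack_actions 1 = [:: (Some 3, [::])] by rewrite /stack_actions; case: op.
(* A history that pops the marker underflows; the stack is then empty and no letter can be read
   before the next block. *)
have dead y : all (leq 2) y -> ~ stack_reach stack_actions (rcons y 1) [::] [::].
  case: y => [_|a y /andP[a1 _]] /= [u]; first by rewrite s1.
  move=> /(mem_stack_actions _ _ a1); case: op => [[] z]; last by case.
  by case=> ? _ [].
elim: x st => [|a x IH] st /= x2 st4.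
  rewrite s1; case: st st4 => [|z st] st4 /=.
    by split=> // _; exists [::]; rewrite ?mem_head.
  by split=> // -[u]; rewrite inE => /eqP[_ ->] /=; case: (st).
case/andP: x2 => a1 x2; have mem_act X u := mem_stack_actions X u a1.
have := op_symbol false a; rewrite /act.
case: (op false a) mem_act => [[] y] /= mem_act y4.
  have [z oz z4] : exists2 z, ohead (rcons st 3) = Some z & z < 4.
    by case: st st4 => [|z st]; [exists 3 | case/andP; exists z].
  have bE : z :: behead (rcons st 3) = rcons st 3 by case: (st) oz => [|? ?] [->].
  rewrite oz -IH //=; last by rewrite y4.
  split=> [[u /mem_act[z' _ [[<-] ->]]]|r]; first by rewrite /rev /= bE.
  exists [:: z; y]; last by rewrite /rev /= bE.
  by apply/mem_act; exists z.
case: st st4 => [|z st] /= st4.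
  by split=> // -[u /mem_act[_ ->]] /= /dead; case.
have st4' : all (gtn 4) st by case/andP: st4.
case: eqP => [->|zy]; last by split=> // -[u /mem_act[[]]].
split=> [[u /mem_act[_ ->]] /=|]; first by move/IH; apply.
by move=> /IH r; exists [::]; [apply/mem_act | apply: r].
Qed.

Lemma stack_reach_valid x : all (leq 2) x ->
  stack_reach stack_actions (block x) [::] [::] <-> valid false x.
Proof.
move=> x2; rewrite /valid -(stack_reach_rcons (st := [::]) x2) //=.
have -> : stack_actions 0 = [:: (None, [:: 3])] by rewrite /stack_actions; case: op.
by split=> [[u]|r]; [rewrite inE => /eqP[->] | exists [:: 3]; rewrite ?mem_head].
Qed.

(** * Compiling recursive functions *)

Inductive prog :=
| Inc of nat
| Clear of nat
| Seq of prog & prog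
| Loop of nat & prog.

Inductive exec : prog -> (nat -> nat) -> (nat -> nat) -> Prop :=
| exec_inc r rho : exec (Inc r) rho (upd rho r (rho r).+1)
| exec_clear r rho : exec (Clear r) rho (upd rho r 0)
| exec_seq p q rho rho1 rho2 :
    exec p rho rho1 -> exec q rho1 rho2 -> exec (Seq p q) rho rho2
| exec_loop0 r p rho : rho r = 0 -> exec (Loop r p) rho rho
| exec_loopS r p n rho rho1 rho2 : rho r = n.+1 -> exec p (upd rho r n) rho1 ->
    exec (Loop r p) rho1 rho2 -> exec (Loop r p) rho rho2.

Fixpoint prog_size (p : prog) : nat :=
  match p with
  | Inc _ | Clear _ => 1
  | Seq p q => prog_size p + prog_size q
  | Loop _ p => (prog_size p).+1
  end.

(* Code for [p] placed at address [a], jumping to [b] at the end. *)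
Fixpoint prog_code (p : prog) (a b : nat) : seq instr :=
  match p with
  | Inc r => [:: INC r b]
  | Clear r => [:: DEC r a b]
  | Seq p q => prog_code p a (a + prog_size p) ++ prog_code q (a + prog_size p) b
  | Loop r p => DEC r a.+1 b :: prog_code p a.+1 a
  end.

Lemma size_prog_code p a b : size (prog_code p a b) = prog_size p.
Proof. by elim: p a b => //= [p IHp q IHq|r p IH] a b; rewrite ?size_cat ?IHp ?IHq ?IH. Qed.

Lemma upd_upd rho r u v : upd (upd rho r u) r v = upd rho r v.
Proof. by apply/funext => r'; rewrite /upd; case: eqP. Qed.

Lemma upd_id rho r : upd rho r (rho r) = rho.
Proof. by apply/funext => r'; rewrite /upd; case: eqP => // ->. Qed.

Lemma upd_eq rho r v : upd rho r v r = v. Proof. by rewrite /upd eqxx. Qed.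

Lemma upd_neq rho (r r' v : nat) : r' != r -> upd rho r v r' = rho r'.
Proof. by rewrite /upd => /negPf->. Qed.

Lemma upd_comm rho (r s u v : nat) : r != s -> upd (upd rho r u) s v = upd (upd rho s v) r u.
Proof.
move=> rs; apply/funext => t; rewrite /upd.
by case: (eqVneq t s) => [->|] //; rewrite eq_sym (negPf rs).
Qed.

Definition runs cd (c c' : mconfig) : Prop := exists n, msteps cd n c c'.

Lemma runs_trans cd c c1 c' : runs cd c c1 -> runs cd c1 c' -> runs cd c c'.
Proof. by case=> n r1 [m r2]; exists (n + m); apply: msteps_cat r1 r2. Qed.

Lemma runs_step cd c c' : mstep cd c = Some c' -> runs cd c c'.
Proof. by move=> st; exists 1; apply: mstepsS st (msteps0 _ _). Qed.

(** Jumps are absolute, hence the context [l], whose size is the address of the code. *)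
Lemma prog_code_runs p rho rho' : exec p rho rho' -> forall l r b,
  let cd := l ++ prog_code p (size l) b ++ r in
  runs cd (size l, rho) (b, rho').
Proof.
have at_head l i s : onth (l ++ i :: s) (size l) = Some i :> option instr.
  by rewrite onth_cat ltnn subnn.
elim=> {p rho rho'}.
- move=> x rho l r b /=; apply: runs_step.
  by rewrite /mstep at_head.
- move=> x rho l r b /=.
  have [n] := ubnP (rho x); elim: n rho => // n IH rho.
  rewrite ltnS leq_eqVlt => xn; case ex: (rho x) => [|m].
    apply: runs_step; rewrite /mstep at_head /= ex.
    by rewrite -{1}ex upd_id.
  have le : upd rho x m x < n by rewrite upd_eq; lia.
  rewrite -(upd_upd rho x m 0); apply: runs_trans (IH _ le).
  by apply: runs_step; rewrite /mstep at_head /= ex.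
- move=> p q rho rho1 rho2 _ IHp _ IHq l r b /=.
  have := IHp l (prog_code q (size l + prog_size p) b ++ r) (size l + prog_size p).
  rewrite /= -catA => r1; apply: runs_trans r1 _.
  have := IHq (l ++ prog_code p (size l) (size l + prog_size p)) r b.
  by rewrite /= size_cat size_prog_code -catA.
- move=> x p rho ex l r b /=; apply: runs_step.
  by rewrite /mstep at_head /= ex.
move=> x p n rho rho1 rho2 ex _ IHp _ IHl l r b /=.
apply: (runs_trans (c1 := ((size l).+1, upd rho x n))).
  by apply: runs_step; rewrite /mstep at_head /= ex.
apply: runs_trans (IHl l r b) => /=.
(* The body follows the loop test and jumps back to it. *)
have := IHp (rcons l (DEC x (size l).+1 b)) r (size l).
by rewrite /= size_rcons cat_rcons.
Qed.

Definition move_to (r s : nat) : prog := Loop r (Inc s).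

(** Emptying [r] fills both [s] and [t]; then [t] restores [r] and is 0 again. *)
Definition copy (r s t : nat) : prog := Seq (Loop r (Seq (Inc s) (Inc t))) (move_to t r).

Lemma exec_move (r s : nat) rho : r != s ->
  exec (move_to r s) rho (upd (upd rho s (rho s + rho r)) r 0).
Proof.
move=> rs; move en: (rho r) => n; elim: n rho en => [|n IH] rho en.
  by rewrite addn0 upd_id -en upd_id; apply: exec_loop0.
apply: (exec_loopS en (exec_inc _ _)).
set rho1 := upd _ s _.
have := IH rho1; rewrite {1}/rho1 upd_neq // upd_eq => /(_ erefl).
congr exec; rewrite /rho1 upd_upd upd_eq upd_neq 1?eq_sym // addSnnS.
by rewrite (upd_comm _ _ _ rs) upd_upd.
Qed.

Lemma exec_copy (r s t : nat) rho : r != s -> r != t -> s != t -> rho t = 0 ->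
  exec (copy r s t) rho (upd rho s (rho s + rho r)).
Proof.
move=> rs rt st t0.
have loop : forall k rho, rho r = k ->
    exec (Loop r (Seq (Inc s) (Inc t))) rho
      (upd (upd (upd rho r 0) s (rho s + k)) t (rho t + k)).
  elim=> [|k IH] rho1 ek.
    have -> : upd rho1 r 0 = rho1 by rewrite -ek upd_id.
    by rewrite !addn0 !upd_id; apply: exec_loop0.
  apply: (exec_loopS ek (exec_seq (exec_inc _ _) (exec_inc _ _))).
  set rho2 := upd _ t _.
  have e2 : rho2 r = k by rewrite /rho2 /upd (negPf rt) (negPf rs) eqxx.
  have := IH rho2 e2.
  congr exec; apply/funext => x; rewrite /rho2 /upd.
  have [_|xt] := eqVneq x t.
    by rewrite eqxx (eq_sym t s) (negPf st) (eq_sym t) (negPf rt) addSnnS.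
  have [_|xs] := eqVneq x s; first by rewrite eqxx (negPf st) (eq_sym s r) (negPf rs) addSnnS.
  by case: (eqVneq x r).
apply: exec_seq (loop _ _ erefl) _; rewrite t0 add0n.
set rho1 := upd _ t _; have := @exec_move t r rho1; rewrite eq_sym => /(_ rt).
congr exec; apply/funext => x; rewrite /rho1 /upd.
have [->|xt] := eqVneq x t; first by rewrite (eq_sym t s) (negPf st) t0.
rewrite eqxx (negPf rs) (negPf rt).
by have [->|//] := eqVneq x r; rewrite eqxx add0n (negPf rs).
Qed.

(** This clears [m.+1] registers, the base case being a program as well. *)
Fixpoint clear_range (b m : nat) : prog :=
  if m is m'.+1 then Seq (Clear b) (clear_range b.+1 m') else Clear b.

Lemma exec_clear_range b m rho :
  exec (clear_range b m) rho (fun r => if b <= r <= b + m then 0 else rho r).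
Proof.
elim: m b rho => [|m IH] b rho /=.
  have := exec_clear b rho; congr exec; apply/funext => r.
  by rewrite /upd addn0 -eqn_leq eq_sym.
apply: exec_seq (exec_clear _ _) _; have := IH b.+1 (upd rho b 0).
congr exec; apply/funext => r; rewrite /upd addSnnS.
by have [->|rb] := eqVneq r b; rewrite ?ltnn ?leqnn ?leq_addr // ltn_neqAle eq_sym rb.
Qed.

(* Registers from [b] on are free and hold 0 before and after execution. *)
Fixpoint compile (f : recfun) (args : seq nat) (out b : nat) : prog :=
  match f with
  | Zero => Clear out
  | Succ => Seq (if args is r :: _ then copy r out b else Clear out) (Inc out)
  | Proj i => if i < size args then copy (nth 0 args i) out b else Clear out
  | Comp f gs =>
      let b' := b + size gs in
      Seq ((fix arguments gs k := if gs is g :: gs' then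
              Seq (compile g args k b') (arguments gs' k.+1) else Clear b') gs b)
        (Seq (compile f (iota b (size gs)) out b') (clear_range b (size gs)))
  | Prec f g =>
      if args is r :: args' then
        Seq (copy r b b.+4) (Seq (compile f args' b.+2 b.+4)
          (Seq (Loop b (Seq (compile g (b.+1 :: b.+2 :: args') b.+3 b.+4)
                  (Seq (Clear b.+2) (Seq (move_to b.+3 b.+2) (Inc b.+1)))))
            (Seq (move_to b.+2 out) (Clear b.+1))))
      else Clear out
  | Mu f =>
      let body := compile f (b :: args) b.+1 b.+2 in
      Seq body (Seq (Loop b.+1 (Seq (Clear b.+1) (Seq (Inc b) body))) (move_to b out))
  end.

(** Only converging computations are described: a decision procedure converges on all legal
    instances. The final register file is exact, so scratch registers are restored. *)
Definition compiles (f : recfun) : Prop := forall xs y args out b rho,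
  eval f xs y -> map rho args = xs -> all (gtn b) args -> out < b ->
  out \notin args -> (forall r, b <= r -> rho r = 0) -> rho out = 0 ->
  exec (compile f args out b) rho (upd rho out y).

(** Induction that also reaches the functions in the list of a [Comp]. *)
Lemma recfun_nested_ind (P : recfun -> Prop) :
  P Zero -> P Succ -> (forall i, P (Proj i)) ->
  (forall f gs, P f -> (forall i, i < size gs -> P (nth Zero gs i)) -> P (Comp f gs)) ->
  (forall f g, P f -> P g -> P (Prec f g)) -> (forall f, P f -> P (Mu f)) ->
  forall f, P f.
Proof.
move=> P0 PS Pp Pc Pr Pm; fix IH 1; case=> [||i|f gs|f g|f].
- exact: P0.
- exact: PS.
- exact: Pp.
- apply: Pc (IH f) _; elim: gs => [|g gs IHgs] i lt.
    rewrite nth_nil; exact: P0.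
  case: i lt => [_|i lt]; [exact: (IH g) | exact: (IHgs i lt)].
- exact: Pr (IH f) (IH g).
exact: Pm (IH f).
Qed.

Lemma compiles_copy i args out b rho : all (gtn b) args -> out < b ->
  out \notin args -> rho b = 0 -> rho out = 0 ->
  exec (if i < size args then copy (nth 0 args i) out b else Clear out) rho
    (upd rho out (nth 0 (map rho args) i)).
Proof.
move=> ab ob oa rb r0; case: ltnP => ia; last first.
  rewrite nth_default ?size_map //; exact: exec_clear.
have nb : nth 0 args i < b := allP ab _ (mem_nth 0 ia).
have na : nth 0 args i != out by apply: contraNneq oa => <-; apply: mem_nth.
have := @exec_copy (nth 0 args i) out b rho na; rewrite (nth_map 0) // r0 add0n.
by apply=> //; rewrite neq_ltn ?nb ?ob.
Qed.

Definition load (rho : nat -> nat) (b : nat) (ys : seq nat) : nat -> nat :=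
  fun r => if b <= r < b + size ys then nth 0 ys (r - b) else rho r.

Lemma compiles_comp f gs : compiles f ->
  (forall i, i < size gs -> compiles (nth Zero gs i)) -> compiles (Comp f gs).
Proof.
move=> Cf Cgs xs y args out b rho ev eargs ab ob oa rb r0.
inversion ev as [| | |? ? ? ys ? sz evgs evf| | |]; subst => /=.
have load0 : load rho b [::] = rho.
  by apply/funext => r; rewrite /load addn0; case: ifP => //; lia.
have load_low zs r : r < b -> load rho b zs r = rho r.
  by rewrite /load => rb'; case: ifP => //; lia.
set b' := b + size gs.
apply: (exec_seq (rho1 := load rho b ys)).
  (* [pre] holds the values of the arguments computed so far. *)
  suff args_exec gs1 ys1 pre : size ys1 = size gs1 -> size pre + size gs1 = size gs ->
      (forall i, i < size gs1 -> eval (nth Zero gs1 i) (map rho args) (nth 0 ys1 i)) ->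
      (forall i, i < size gs1 -> compiles (nth Zero gs1 i)) ->
      exec ((fix arguments gs k := if gs is g :: gs' then
              Seq (compile g args k b') (arguments gs' k.+1) else Clear b')
              gs1 (b + size pre)) (load rho b pre) (load rho b (pre ++ ys1)).
    by have := args_exec gs ys [::]; rewrite addn0 load0; apply.
  elim: gs1 ys1 pre => [|g gs1 IH] [|z ys1] pre // szy szp evg Cg.
    (* The closing [Clear b'] changes nothing, as [b'] already holds 0. *)
    have := exec_clear b' (load rho b (pre ++ [::])); rewrite cats0.
    congr exec; rewrite -[RHS](upd_id _ b'); congr upd; rewrite /load.
    by case: ifP => [|_]; [rewrite /b'; move: szp => /=; lia | rewrite rb ?leq_addr].
  have szp' : size (rcons pre z) + size gs1 = size gs by rewrite size_rcons addSnnS.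
  have lt : b + size pre < b' by rewrite /b' -szp /=; lia.
  apply: (exec_seq (rho1 := load rho b (rcons pre z))); last first.
    rewrite -cat_rcons -addnS -(size_rcons pre z); apply: IH => //.
    - by case: szy.
    - by move=> i; apply: (evg i.+1).
    by move=> i; apply: (Cg i.+1).
  have -> : load rho b (rcons pre z) = upd (load rho b pre) (b + size pre) z.
    apply/funext => r; rewrite /load /upd size_rcons nth_rcons.
    have [->|rp] := eqVneq r (b + size pre).
      by rewrite leq_addr addnS ltnS leqnn addKn ltnn eqxx.
    have -> : (b <= r < b + (size pre).+1) = (b <= r < b + size pre) by lia.
    by case: ifP => // brp; rewrite ifT //; lia.
  have mapE : map (load rho b pre) args = map rho args.
    by apply/eq_in_map => r /(allP ab); apply: load_low.
  apply: (Cg 0 _ _ _ _ _ _ _ (evg 0 _)) => //.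
  - by apply: sub_all ab => r; rewrite /b' /=; lia.
  - by apply/negP => /(allP ab) /=; lia.
  - by move=> r rb'; rewrite /load ifF ?rb //; lia.
  by rewrite /load ifF ?rb //; lia.
have ysz : size ys = size gs by [].
apply: (exec_seq (rho1 := upd (load rho b ys) out y)).
  apply: (Cf ys) => //.
  - apply: (@eq_from_nth _ 0); rewrite size_map size_iota // => i igs.
    by rewrite (nth_map 0) ?size_iota // nth_iota // /load leq_addr ltn_add2l ysz igs addKn.
  - by apply/allP => r; rewrite mem_iota => /andP[].
  - by rewrite /b'; lia.
  - by rewrite mem_iota; lia.
  - by move=> r; rewrite /b' /load ysz => rb'; rewrite ifF ?rb //; lia.
  by rewrite load_low.
have := exec_clear_range b (size gs) (upd (load rho b ys) out y).
congr exec; apply/funext => r; rewrite /upd /load ysz.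
have [->|ro] := eqVneq r out; first by rewrite ifF //; lia.
case: ifP => [/andP[br _]|nr]; first by rewrite rb.
by rewrite ifF //; lia.
Qed.

(** Unrolls the recursion into the sequence [r] of its intermediate values. *)
Lemma eval_prec_inv f g n xs y : eval (Prec f g) (n :: xs) y ->
  exists r : nat -> nat, [/\ eval f xs (r 0), r n = y &
    forall k, k < n -> eval g [:: k, r k & xs] (r k.+1)].
Proof.
elim: n y => [|n IH] y ev; inversion ev; subst; first by exists (fun=> y).
have [r' [r0 rn rS]] := IH _ ltac:(eassumption); subst.
exists (fun k => if k <= n then r' k else y); split; rewrite ?leq0n ?ltnn // => k.
rewrite ltnS leq_eqVlt => /orP[/eqP->|kn] /=; first by rewrite eqxx ltnn.
by rewrite kn orbT; apply: rS.
Qed.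

Ltac upd_solve :=
  let x := fresh "x" in
  apply/funext => x; rewrite /upd;
  repeat match goal with |- context [?a == ?b] => case: (@eqP _ a b) => ? end;
  subst; try lia.

Lemma map_below (rho rho' : nat -> nat) args b : all (gtn b) args ->
  (forall r, r < b -> rho' r = rho r) -> map rho' args = map rho args.
Proof. by move=> ab e; apply/eq_in_map => r /(allP ab); apply: e. Qed.

Lemma compiles_prec f g : compiles f -> compiles g -> compiles (Prec f g).
Proof.
move=> Cf Cg xs y [|r args] out b rho ev exs ab ob oa rb r0.
  by inversion ev; subst.
case/andP: ab => /= rlt ab; move: oa; rewrite inE negb_or => /andP[or oa].
have [n [xs' exs']] : exists n xs', xs = n :: xs' by inversion ev; subst; eexists; eexists.
rewrite {}exs' in exs ev; case: exs => rn exs'.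
have [v [v0 vn vS]] := eval_prec_inv ev.
have [z0 z1 z2 z3] : [/\ rho b = 0, rho b.+1 = 0, rho b.+2 = 0 & rho b.+3 = 0].
  by split; apply: rb; lia.
have up c : all (gtn (b + c)) args by apply: sub_all ab => k /=; lia.
have notin c : b + c \notin args by apply/negP => /(allP ab) /=; lia.
(* Register [b] holds the number of iterations left, [b.+1] the index and [b.+2] the current value;
   [b.+3] receives the next value. *)
pose S k i := upd (upd (upd rho b k) b.+1 i) b.+2 (v i).
have Slow k i q : q < b -> S k i q = rho q.
  by move=> qb; rewrite /S /upd; do 3![case: eqP => [?|_]; first by lia].
simpl compile; apply: (exec_seq (rho1 := upd rho b n)).
  have := @exec_copy r b b.+4 rho; rewrite z0 rn add0n; apply; rewrite ?rb //; lia.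
apply: (exec_seq (rho1 := S n 0)).
  have -> : S n 0 = upd (upd rho b n) b.+2 (v 0) by rewrite /S; upd_solve.
  apply: (Cf _ _ _ _ _ _ v0); rewrite ?rn; try lia.
  - by rewrite -exs'; apply: map_below ab _ => q qb; rewrite upd_neq // neq_ltn qb.
  - by have := up 4; rewrite addn4.
  - by have := notin 2; rewrite addn2.
  - by move=> q qb; rewrite upd_neq ?rb //; lia.
  by rewrite upd_neq //; lia.
apply: (exec_seq (rho1 := S 0 n)).
  suff loop k i : i + k = n -> exec (Loop b (Seq (compile g [:: b.+1, b.+2 & args] b.+3 b.+4)
      (Seq (Clear b.+2) (Seq (move_to b.+3 b.+2) (Inc b.+1))))) (S k i) (S 0 n).
    by apply: loop; rewrite add0n.
  elim: k i => [|k IH] i ik.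
    have -> : i = n by lia.
    by apply: exec_loop0; rewrite /S /upd eqxx; do 2![case: eqP => [?|_]; first by lia].
  apply: (@exec_loopS b _ k _ (S k i.+1)); last by apply: IH; lia.
    by rewrite /S /upd eqxx; do 2![case: eqP => [?|_]; first by lia].
  have -> : upd (S k.+1 i) b k = S k i by rewrite /S; upd_solve.
  apply: (exec_seq (rho1 := upd (S k i) b.+3 (v i.+1))).
    apply: (Cg _ _ _ _ _ _ (vS i _)); try lia.
    - rewrite /= -exs' (map_below ab (Slow k i)) /S upd_eq; congr [:: _, _ & _].
      by rewrite upd_neq ?upd_eq //; lia.
    - by have := up 4; rewrite addn4 /= => ->; rewrite andbT; lia.
    - by have := notin 3; rewrite addn3 !inE => /negPf->; rewrite orbF; lia.
    - by move=> q qb; rewrite /S !upd_neq ?rb //; lia.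
    by rewrite /S !upd_neq //; lia.
  apply: exec_seq (exec_clear _ _) _; apply: exec_seq (exec_move _ _) _; first by lia.
  set rho3 := upd (upd _ _ _) _ _.
  have -> : S k i.+1 = upd rho3 b.+1 (rho3 b.+1).+1; last exact: exec_inc.
  by rewrite /rho3 /S; upd_solve.
apply: exec_seq (exec_move _ _) _; first by lia.
set rho3 := upd (upd _ _ _) _ _.
have -> : upd rho out y = upd rho3 b.+1 0; last exact: exec_clear.
by rewrite /rho3 /S -vn; upd_solve.
Qed.

Lemma compiles_mu f : compiles f -> compiles (Mu f).
Proof.
move=> Cf xs y args out b rho ev exs ab ob oa rb r0.
inversion ev as [| | | | | |? ? ? v ev0 evS]; subst.
(* The value of [f] at candidate [k], kept in [b.+1]; it becomes 0 at [y], which ends the loop. *)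
pose w k := if k < y then (v k).+1 else 0.
have evw k : k <= y -> eval f (k :: map rho args) (w k).
  by rewrite leq_eqVlt /w => /orP[/eqP->|ky]; rewrite ?ltnn ?ky //; apply: evS.
have [z0 z1] : rho b = 0 /\ rho b.+1 = 0 by rewrite !rb.
pose S k i := upd (upd rho b k) b.+1 i.
have body k : k <= y -> exec (compile f (b :: args) b.+1 b.+2) (S k 0) (S k (w k)).
  move=> ky; have -> : S k (w k) = upd (S k 0) b.+1 (w k) by rewrite /S upd_upd.
  apply: (Cf _ _ _ _ _ _ (evw k ky)); try lia.
  - rewrite /=; congr cons; first by rewrite /S upd_neq ?upd_eq //; lia.
    by apply: map_below ab _ => q qb; rewrite /S !upd_neq //; lia.
  - by rewrite /=; apply/andP; split; [lia | apply: sub_all ab => q /=; lia].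
  - by rewrite inE negb_or; apply/andP; split; [lia | apply/negP => /(allP ab) /=; lia].
  - by move=> q qb; rewrite /S !upd_neq ?rb //; lia.
  by rewrite /S upd_eq.
simpl compile; apply: (exec_seq (rho1 := S 0 (w 0))).
  have -> : rho = S 0 0 by rewrite /S; upd_solve.
  exact: body.
apply: (exec_seq (rho1 := S y 0)).
  suff loop k i : i + k = y -> exec (Loop b.+1 (Seq (Clear b.+1) (Seq (Inc b)
      (compile f (b :: args) b.+1 b.+2)))) (S i (w i)) (S y 0).
    by apply: (loop y).
  elim: k i => [|k IH] i ik.
    have -> : i = y by lia.
    by rewrite /w ltnn; apply: exec_loop0; rewrite /S upd_eq.
  have iy : i < y by lia.
  apply: (@exec_loopS _ _ (v i) _ (S i.+1 (w i.+1))); last by apply: IH; lia.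
    by rewrite /S /w upd_eq iy.
  apply: exec_seq (exec_clear _ _) _; apply: exec_seq (exec_inc _ _) _.
  set rho3 := upd _ b _.
  have -> : rho3 = S i.+1 0 by rewrite /rho3 /S; upd_solve.
  exact: body.
have -> : upd rho out y = upd (upd (S y 0) out (S y 0 out + S y 0 b)) b 0.
  by rewrite /S; upd_solve.
by apply: exec_move; lia.
Qed.

Lemma compilesP f : compiles f.
Proof.
elim/recfun_nested_ind: f => [||i|f gs|f g|f].
- move=> xs y args out b rho ev _ _ _ _ _ _; inversion ev; subst.
  exact: exec_clear.
- move=> xs y args out b rho ev exs ab ob oa rb r0; inversion ev; subst.
  have := @compiles_copy 0 args out b rho ab ob oa (rb _ (leqnn _)) r0.
  set v := nth 0 (map rho args) 0 => ex; apply: (exec_seq (rho1 := upd rho out v)).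
    by case: (args) ex.
  have -> : upd rho out v.+1 = upd (upd rho out v) out (upd rho out v out).+1.
    by rewrite upd_upd upd_eq.
  exact: exec_inc.
- move=> xs y args out b rho ev exs ab ob oa rb r0; inversion ev; subst.
  exact: (compiles_copy i ab ob oa (rb _ (leqnn _)) r0).
- exact: compiles_comp.
- exact: compiles_prec.
exact: compiles_mu.
Qed.

(** Two decrements of the output register lead to [n.+2], the halting address, iff the output is 1.
    Otherwise the machine stops at [n.+3], beyond the code. *)
Definition accept_code (f : recfun) : seq instr :=
  let p := compile f [:: 0] 1 2 in
  let n := prog_size p in
  prog_code p 0 n ++ [:: DEC 1 n.+1 n.+3; DEC 1 n.+3 n.+2].

Lemma mstep_deterministic cd n m c c1 c2 : msteps cd n c c1 -> msteps cd m c c2 ->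
  mstep cd c1 = None -> mstep cd c2 = None -> c1 = c2.
Proof.
move=> st; elim: st m c2 => [d|k d d1 d' sd st IH] m c2 st2 stop1 stop2.
  by inversion st2 as [|? ? ? ? sd]; subst => //; rewrite sd in stop1.
inversion st2 as [|? ? e1 ? sd' st2']; subst; first by rewrite sd in stop2.
by move: sd'; rewrite sd => -[e]; subst e1; apply: IH st2' stop1 stop2.
Qed.

Lemma accept_codeP f e y : eval f [:: e] y -> halts (accept_code f) e <-> y = 1.
Proof.
move=> ev; rewrite /halts /accept_code.
set p := compile _ _ _ _; set n := prog_size p; set cd := _ ++ _.
have szc : size (prog_code p 0 n) = n by rewrite size_prog_code.
have szcd : size cd = n.+2 by rewrite size_cat szc addn2.
have ex : exec p (input e) (upd (input e) 1 y).
  by apply: (compilesP ev) => // -[|[]].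
have [k r1] := prog_code_runs ex [::] [:: DEC 1 n.+1 n.+3; DEC 1 n.+3 n.+2] n.
rewrite -[[::] ++ _]/cd in r1.
have cd0 : onth cd n = Some (DEC 1 n.+1 n.+3) by rewrite onth_cat szc ltnn subnn.
have cd1 : onth cd n.+1 = Some (DEC 1 n.+3 n.+2).
  by rewrite onth_cat szc ltnNge leqnSn subSnn.
have stop a rho : n.+1 < a -> mstep cd (a, rho) = None.
  by move=> na; rewrite /mstep onth_default // szcd.
have fin : exists rho, runs cd (0, input e) (if y == 1 then n.+2 else n.+3, rho).
  case: y ev ex r1 => [|[|y]] ev ex r1; eexists; apply: runs_trans (ex_intro _ k r1) _.
  - by apply: runs_step; rewrite /mstep /= cd0.
  - apply: runs_trans (runs_step _) _; first by rewrite /mstep /= cd0.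
    by apply: runs_step; rewrite /mstep cd1.
  - apply: runs_trans (runs_step _) _; first by rewrite /mstep /= cd0.
    by apply: runs_step; rewrite /mstep cd1.
have [rho [m rm]] := fin; rewrite szcd.
split=> [[m' [rho' rm']]|y1]; last by exists m, rho; move: rm; rewrite y1.
have s1 : mstep cd (if y == 1 then n.+2 else n.+3, rho) = None.
  by apply: stop; case: ifP.
have [] := mstep_deterministic rm rm' s1 (stop n.+2 rho' (leqnn _)).
by case: eqP => // _; lia.
Qed.

(** * Computing the instances *)

Definition recursive (F : seq nat -> nat) : Prop :=
  exists f, forall xs, eval f xs (F xs).

Lemma recursive_ext F F' : F =1 F' -> recursive F -> recursive F'.
Proof. by move=> e [f ef]; exists f => xs; rewrite -e. Qed.

Lemma recursive_proj i : recursive (nth 0 ^~ i).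
Proof. by exists (Proj i) => xs; constructor. Qed.

Lemma recursive_succ F : recursive F -> recursive (fun xs => (F xs).+1).
Proof.
move=> [f ef]; exists (Comp Succ [:: f]) => xs.
by apply: (@eval_comp _ _ _ [:: F xs]) => //; [case | constructor].
Qed.

Lemma recursive_const n : recursive (fun=> n).
Proof.
by elim: n => [|n IH]; [exists Zero => xs; constructor | apply: recursive_succ].
Qed.

Lemma recursive_rec B S N P : recursive B -> recursive S -> recursive N -> recursive P ->
  recursive (fun xs => nat_rect (fun=> nat) (B [:: P xs])
    (fun k r => S [:: k; r; P xs]) (N xs)).
Proof.
move=> [b eb] [s es] rN rP.
have [n en] := rN; have [p ep] := rP.
exists (Comp (Prec b s) [:: n; p]) => xs.
apply: (@eval_comp _ _ _ [:: N xs; P xs]) => //; first by case=> [|[|]].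
elim: (N xs) => [|k IH] /=; [exact: eval_prec0 | exact: eval_precS IH (es _)].
Qed.

Lemma recursive_double F : recursive F -> recursive (fun xs => (F xs).*2).
Proof.
move=> rF; have := recursive_rec (recursive_const 0)
  (recursive_succ (recursive_succ (recursive_proj 1))) rF (recursive_const 0).
by apply: recursive_ext => xs /=; elim: (F xs) => //= n ->.
Qed.

(** The formula is the code of a sequence with head [F xs] whose tail has code [G xs]. *)
Lemma recursive_cons F G : recursive F -> recursive G ->
  recursive (fun xs => 2 ^ F xs * (G xs).*2.+1).
Proof.
move=> rF rG; have := recursive_rec
  (recursive_succ (recursive_double (recursive_proj 0)))
  (recursive_double (recursive_proj 1)) rF rG.
apply: recursive_ext => xs /=; elim: (F xs) => [|n /= ->]; first by rewrite mul1n.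
by rewrite expnS -mulnA mul2n.
Qed.

Lemma recursive_code F L : recursive F -> recursive (fun xs => CodeSeq.code (L xs)) ->
  recursive (fun xs => CodeSeq.code (F xs :: L xs)).
Proof. exact: recursive_cons. Qed.

Lemma recursive_code_transition Q a X Q' u : recursive Q -> recursive Q' ->
  recursive (fun xs => code_transition (Q xs, a, X, Q' xs, u)).
Proof.
move=> rQ rQ'; do ?[apply: recursive_code => //; try exact: recursive_const].
Qed.

Lemma recursive_below F : recursive F -> recursive (fun xs => CodeSeq.code (below (F xs))).
Proof.
move=> rF; have := recursive_rec (recursive_const 0)
  (recursive_cons (recursive_proj 0) (recursive_proj 1)) rF (recursive_const 0).
by apply: recursive_ext => xs /=; elim: (F xs) => //= n ->.
Qed.

(** The effect on codes of prepending an [edge] to a list of transitions with code [r]. *)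
Definition edge_code q a q' (l : seq (option stack_symbol * seq stack_symbol)) r : nat :=
  foldr (fun p r => 2 ^ code_transition (q, a, p.1, q', p.2) * r.*2.+1) r l.

Lemma edge_codeE actions c a c' s : CodeSeq.code (map code_transition (edge actions c a c' ++ s)) =
  edge_code (ctl_num c) a (ctl_num c') (actions a) (CodeSeq.code (map code_transition s)).
Proof. by rewrite /edge; elim: (actions a) => //= p l ->. Qed.

Lemma recursive_edge_code Q a Q' l R : recursive Q -> recursive Q' -> recursive R ->
  recursive (fun xs => edge_code (Q xs) a (Q' xs) l (R xs)).
Proof.
move=> rQ rQ' rR; elim: l => [|p l IH] //=.
by apply: recursive_cons IH; apply: recursive_code_transition.
Qed.

(** [G] is chosen before [cd] and [K]: these enter the automaton's code only through [core_code]. *)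
Lemma product_code_recursive gamma actions wf : exists2 G, recursive G &
  forall cd K, code_pda (@product cd K gamma actions wf) = G [:: core_code cd K actions].
Proof.
(* The recursion starts from [e] because [e] is both the length of the chain and the code of [core]
   at its end. *)
pose chain_code e := nat_rect (fun=> nat) e (fun k r =>
  edge_code k.+1.*2.+1 3 k.*2.+1 (actions 3) r) e.
pose e := nth 0 ^~ 0 : seq nat -> nat.
exists (fun xs => CodeSeq.code [:: CodeSeq.code alphabet; CodeSeq.code gamma;
    CodeSeq.code (below (e xs).*2.+3); CodeSeq.code [:: 0];
    (* 2 is the number of [Start], and [(e xs).*2.+1] that of [Chain (e xs)]. *)
    edge_code 2 4 (e xs).*2.+1 (actions 4) (chain_code (e xs)); CodeSeq.code [:: 0]]).
  have re : recursive e := recursive_proj 0.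
  do 2![apply: recursive_code; first exact: recursive_const].
  apply: recursive_code; first by apply: recursive_below; do 3!apply: recursive_succ;
    apply: recursive_double.
  apply: recursive_code; first exact: recursive_const.
  apply: recursive_code; last exact: recursive_const.
  apply: recursive_edge_code; first exact: recursive_const.
    exact: recursive_succ (recursive_double re).
  have := recursive_rec (recursive_proj 0) (recursive_edge_code 3 (actions 3)
    (recursive_succ (recursive_double (recursive_succ (recursive_proj 0))))
    (recursive_succ (recursive_double (recursive_proj 0))) (recursive_proj 1)) re re.
  exact: recursive_ext.
move=> cd K.
have chainE n : CodeSeq.code (map code_transition (chain cd K actions n)) =
    nat_rect (fun=> nat) (core_code cd K actions) (fun k r =>
    edge_code k.+1.*2.+1 3 k.*2.+1 (actions 3) r) n.
  by elim: n => //= n <-; rewrite edge_codeE.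
rewrite /code_pda [map _ _]/(map code_transition (product_delta cd K actions _)).
rewrite /product_delta edge_codeE chainE; reflexivity.
Qed.

(** * The diagonal argument and the reductions *)

Definition register_bound (cd : seq instr) : nat :=
  (foldr (fun i m => maxn (reg i) m) 0 cd).+1.

Lemma reg_bound cd p i : onth cd p = Some i -> reg i < register_bound cd.
Proof.
rewrite /register_bound ltnS; elim: cd p => [|j cd IH] [|p] //=.
  by case=> ->; apply: leq_maxl.
by move/IH => le; apply: leq_trans le (leq_maxr _ _).
Qed.

(** The machine applies the presumed procedure to [G] of its input. On the input [input_of cd] it
    thus evaluates its own instance, and halts iff the procedure answers 1, that is, iff it does not
    halt. *)
Lemma undecidable_halting (P : problem) (inst : seq instr -> instance P)
    (input_of : seq instr -> nat) G :
  recursive G -> (forall cd, encode (inst cd) = G [:: input_of cd]) ->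
  (forall cd, legal (inst cd)) ->
  (forall cd, answer (inst cd) <-> ~ halts cd (input_of cd)) -> undecidable P.
Proof.
move=> [g eg] encG leg ans [f dec].
pose cd := accept_code (Comp f [:: g]).
have [yes no] := dec _ (leg cd).
have run_f y : eval f [:: encode (inst cd)] y -> halts cd (input_of cd) <-> y = 1.
  move=> ev; apply: accept_codeP; apply: (@eval_comp _ _ _ [:: encode (inst cd)]) => //.
  by case=> // _; rewrite encG; apply: eg.
have [h|nh] := pselect (halts cd (input_of cd)).
  have nans : ~ answer (inst cd) by move/ans.
  by have := (run_f 0 (no nans)).1 h.
have yans : answer (inst cd) by apply/ans.
by apply: nh; apply/(run_f 1 (yes yans)).
Qed.

Lemma nfa_actions_wf (gamma : seq stack_symbol) : all (fun a => all (fun p =>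
  (if p.1 is Some x then x \in gamma else true) && all (mem gamma) p.2)
  (nfa_actions a)) alphabet.
Proof. by []. Qed.

Lemma stack_actions_wf : all (fun a => all (fun p =>
  (if p.1 is Some x then x \in symbols else true) && all (mem symbols) p.2)
  (stack_actions a)) alphabet.
Proof. by vm_compute. Qed.

Definition control_dfa (cd : seq instr) : pda :=
  product cd (register_bound cd) (nfa_actions_wf [::]).

Definition control_dpda (cd : seq instr) : pda :=
  product cd (register_bound cd) stack_actions_wf.

(** A DFA belongs to all four classes, so one reduction serves them all. *)
Lemma control_dfa_class C cd : in_class C (control_dfa cd).
Proof.
have det : deterministic (control_dfa cd).
  by apply: product_deterministic => a X u1 u2; rewrite !inE => /eqP[_ ->] /eqP[_ ->].
by case: C.
Qed.

Lemma control_dpda_deterministic cd : deterministic (control_dpda cd).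
Proof.
apply: product_deterministic => a X u1 u2; rewrite /stack_actions.
case: op => push y; case: ifP => _; first by rewrite !inE => /eqP[_ ->] /eqP[_ ->].
case: ifP => _; first by rewrite !inE => /eqP[_ ->] /eqP[_ ->].
case: push; last by rewrite !inE => /eqP[_ ->] /eqP[_ ->].
by move=> /mapP[x _ [-> ->]] /mapP[x' _ [-> ->]].
Qed.

Lemma ctl_path_data cd K e x c c' : all (leq 2) x -> ctl_path cd K e x c c' -> data x.
Proof.
elim: x c => //= a x IH c /andP[a2 x2]; case nc: ctl_next => [d|] // /(IH _ x2) ->.
by move: (ctl_next_alphabet nc); rewrite mem_iota a2 andbT.
Qed.

Lemma blocks_sub (X Y : seq letter -> Prop) w :
  (forall x, X x -> Y x) -> blocks X w -> blocks Y w.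
Proof. by move=> XY [xs Xxs ->]; exists xs => // x /Xxs /XY. Qed.

Lemma control_dfa_distance cd :
  (halts cd (core_code cd (register_bound cd) nfa_actions) ->
    lang_ed (language (control_dfa cd)) (language guess) = +oo%E) /\
  (~ halts cd (core_code cd (register_bound cd) nfa_actions) ->
    (lang_ed (language (control_dfa cd)) (language guess) <= 0%:Z%:E)%E).
Proof.
have P x : block_lang (control_dfa cd) x <-> all (leq 2) x /\ ctl_path cd
    (register_bound cd) (core_code cd (register_bound cd) nfa_actions) x Start Erase.
  rewrite product_blocks; split=> [[]//|[x2 px]]; split=> //.
  exact: stack_reach_nfa.
have L1 w := @block_language (control_dfa cd) w (fun=> erefl) (fun=> erefl)
  (product_block_transitions cd _ (nfa_actions_wf [::]) isT).
have L2 w := @block_language guess w (fun=> erefl) (fun=> erefl) guess_block_transitions.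
have haltsE := ctl_pathP (core_code cd (register_bound cd) nfa_actions) (@reg_bound cd).
have [||w|yes no] := lang_ed_blocks L1 (V := fun x => valid false x /\ valid true x)
    (L2 := language guess).
- by move=> x [].
- move=> w bw; apply/L2; apply: blocks_sub bw => x [/P[x2 px] nv].
  by apply: (guess_blocks x).1 => //; apply: ctl_path_data px.
- by move/L2; apply: blocks_sub => x bx; split; [case: bx | apply: (guess_blocks x).2].
split=> [/haltsE[x [x2 px v1 v2]]|nh]; first by apply: yes; exists x => //; apply/P.
by apply: no => -[x /P[x2 px] [v1 v2]]; apply: nh; apply/haltsE; exists x.
Qed.

Lemma control_dpda_distance cd :
  (halts cd (core_code cd (register_bound cd) stack_actions) ->
    lang_ed (language (control_dpda cd)) (language watch) = +oo%E) /\
  (~ halts cd (core_code cd (register_bound cd) stack_actions) ->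
    (lang_ed (language (control_dpda cd)) (language watch) <= 0%:Z%:E)%E).
Proof.
have P x : block_lang (control_dpda cd) x <-> [/\ all (leq 2) x, ctl_path cd
    (register_bound cd) (core_code cd (register_bound cd) stack_actions) x Start Erase &
    valid false x].
  by rewrite product_blocks; split=> -[x2 px] /(stack_reach_valid x2).
have L1 w := @block_language (control_dpda cd) w (fun=> erefl) (fun=> erefl)
  (product_block_transitions cd _ stack_actions_wf isT).
have L2 w := @block_language watch w (fun=> erefl) (fun=> erefl) watch_block_transitions.
have haltsE := ctl_pathP (core_code cd (register_bound cd) stack_actions) (@reg_bound cd).
have [||w|yes no] := lang_ed_blocks L1 (V := valid true) (L2 := language watch).
- by move=> x [].
- move=> w bw; apply/L2; apply: blocks_sub bw => x [/P[x2 px v1] nv].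
  by apply: (watch_blocks x).1 => //; apply: ctl_path_data px.
- by move/L2; apply: blocks_sub => x bx; split; [case: bx | apply: (watch_blocks x).2].
split=> [/haltsE[x [x2 px v1 v2]]|nh]; first by apply: yes; exists x => //; apply/P.
by apply: no => -[x /P[x2 px v1] v2]; apply: nh; apply/haltsE; exists x.
Qed.

(** The distance is either at most 0 or infinite, so threshold 0 and finiteness express the same
    condition. *)
Lemma distance_le (d : \bar int) (h : Prop) : (h -> d = +oo%E) ->
  (~ h -> (d <= 0%:Z%:E)%E) -> (d <= 0%:Z%:E)%E <-> ~ h.
Proof. by move=> far near; split=> [le /far e|/near//]; rewrite e in le. Qed.

Lemma distance_lt (d : \bar int) (h : Prop) : (h -> d = +oo%E) ->
  (~ h -> (d <= 0%:Z%:E)%E) -> (d < +oo)%E <-> ~ h.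
Proof.
move=> far near; split=> [lt /far e|/near le]; first by rewrite e in lt.
exact: Order.POrderTheory.le_lt_trans le (ltry _).
Qed.

Theorem proposition3 :
  (forall C : pda_class, undecidable (TED C PDA) /\ undecidable (FED C PDA)) /\
  (forall C : pda_class, C = DPDA \/ C = PDA -> undecidable (FED C DPDA)).
Proof.
have [G rG GE] := product_code_recursive (nfa_actions_wf [::]).
have [G' rG' GE'] := product_code_recursive stack_actions_wf.
split=> [C|C CE].
  split.
    apply: (@undecidable_halting (TED C PDA) (fun cd => (control_dfa cd, guess, 0))
      (fun cd => core_code cd (register_bound cd) nfa_actions)
      (fun xs => CodeSeq.code [:: G xs; code_pda guess; 0])).
    - exact: (@recursive_code G (fun=> [:: code_pda guess; 0])) rG (recursive_const _).
    - move=> cd; rewrite -GE; reflexivity.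
    - by move=> cd; split=> //; apply: control_dfa_class.
    by move=> cd; have [far near] := control_dfa_distance cd; apply: distance_le.
  apply: (@undecidable_halting (FED C PDA) (fun cd => (control_dfa cd, guess))
    (fun cd => core_code cd (register_bound cd) nfa_actions)
    (fun xs => CodeSeq.code [:: G xs; code_pda guess])).
  - exact: (@recursive_code G (fun=> [:: code_pda guess])) rG (recursive_const _).
  - move=> cd; rewrite -GE; reflexivity.
  - by move=> cd; split=> //; apply: control_dfa_class.
  by move=> cd; have [far near] := control_dfa_distance cd; apply: distance_lt.
apply: (@undecidable_halting (FED C DPDA) (fun cd => (control_dpda cd, watch))
  (fun cd => core_code cd (register_bound cd) stack_actions)
  (fun xs => CodeSeq.code [:: G' xs; code_pda watch])).
- exact: (@recursive_code G' (fun=> [:: code_pda watch])) rG' (recursive_const _).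
- move=> cd; rewrite -GE'; reflexivity.
- move=> cd; split; last exact: watch_deterministic.
  by case: CE => ->; [apply: control_dpda_deterministic |].
by move=> cd; have [far near] := control_dpda_distance cd; apply: distance_lt.
Qed.
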